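(* Let $\mathbb{F}$ be any field and let $L$ be a nilpotent symplectic alternating algebra over $\mathbb{F}$ of dimension $10$ with an isotropic center of dimension $4$ that is of type $C$. Then $L$ has a presentation of the form $$\mathcal{P}_{10}^{(4,4)}(\alpha,\beta):\quad (x_1y_2,y_3)=1,\ (x_1y_3,y_4)=\alpha,\ (x_1y_4,y_5)=\beta,\ (y_1y_2,y_5)=1,\ (y_1y_3,y_4)=1,$$ where $\alpha,\beta\in\mathbb{F}$ and the polynomial $t^2+\alpha t+\beta$ is irreducible in $\mathbb{F}[t]$. Conversely any such presentation gives us an algebra of type $C$. Furthermore two such presentations $\mathcal{P}_{10}^{(4,4)}(\alpha,\beta)$ and $\mathcal{P}_{10}^{(4,4)}(\tilde\alpha,\tilde\beta)$ describe the same algebra if and only if $$\tilde\alpha=\frac{(ad+bc)\alpha+2ac\beta+2bd}{d^2+cd\alpha+c^2\beta},\qquad \tilde\beta=\frac{b^2+ab\alpha+a^2\beta}{d^2+cd\alpha+c^2\beta}$$ for some $a,b,c,d\in\mathbb{F}$ where $ad-bc=1$.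
   Context: A symplectic alternating algebra (SAA) over a field $\mathbb{F}$ is a finite-dimensional vector space $L$ over $\mathbb{F}$ with a non-degenerate alternating bilinear form $(\ ,\ )$ and a bilinear product $\cdot$ satisfying $u\cdot u=0$ for all $u$ and $(u\cdot v,w)=(v\cdot w,u)$ for all $u,v,w\in L$. No associativity or Jacobi identity is assumed. The map $(u,v,w)\mapsto(uv,w)$ is then an alternating trilinear form. A standard basis (in dimension $10$) is a basis $x_1,y_1,\ldots,x_5,y_5$ with $(x_i,x_j)=(y_i,y_j)=0$ and $(x_i,y_j)=\delta_{ij}$ for all $i,j$. Presentations: $L$ has (is described by) a presentation if there is a standard basis for which the listed values of triples $(uv,w)$ hold and $(uv,w)=0$ for all triples of basis elements that are not a reordering of a listed one. Two presentations describe the same algebra if the corresponding $10$-dimensional SAA's are isomorphic (by a linear bijection preserving product and form). $L^1=L$, $L^{m+1}=L^mL$ (span of products). $L$ is nilpotent if $L^{m+1}=\{0\}$ for some $m\ge 0$. The center is $Z(L)=\{x\in L: xL=\{0\}\}$; it is isotropic if $(u,v)=0$ for all $u,v\in Z(L)$. Type $C$: this notion applies to nilpotent $L$ of dimension $10$ with isotropic center of dimension $4$ and $L^3=Z(L)$. Then $L^2=Z(L)^{\perp}$ is abelian of dimension $6$, so $L^2/Z(L)$ has dimension $2$ and $L/L^2$ has dimension $4$. For each $\bar z=z+Z(L)\in L^2/Z(L)$ there is a well-defined alternating form $\phi_{\bar z}:L/L^2\times L/L^2\to\mathbb{F}$, $\phi_{\bar z}(u+L^2,v+L^2)=(zu,v)$.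 $L$ is of type $C$ if $\phi_{\bar z}$ is non-degenerate for all $0\neq\bar z\in L^2/Z(L)$. *)

(* Defs.v *)
From HB Require Import structures.
From mathcomp Require Import all_boot all_order all_algebra.
Set Implicit Arguments.
Unset Strict Implicit.
Unset Printing Implicit Defensive.
Import GRing.Theory.
Local Open Scope ring_scope.

(* The product is not assumed associative, so L is not an algType.  The form is
   required to be alternating, which in characteristic 2 is more than the
   skew-symmetry of {skew_symmetric L}. *)
Record saa (F : fieldType) := SAA {
  saa_carrier :> vectType F;
  form : {biscalar saa_carrier};
  mul : {bilinear saa_carrier -> saa_carrier -> saa_carrier};
  form_alt : forall u, form u u = 0;
  form_nondeg : forall u, (forall v, form u v = 0) -> u = 0;
  mul_alt : forall u, mul u u = 0;
  form_mul : forall u v w, form (mul u v) w = form (mul v w) u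
}.

Arguments form {F s}.
Arguments mul {F s}.

Section Subspaces.
Variables (F : fieldType) (L : saa F).
Implicit Types (u v w : L) (U V W : {vspace L}).

(* Same definition as prodv in falgebra, which only covers associative unital
   algebras; mulvP characterises it as the span of all products. *)
Definition mulv U V : {vspace L} := <<[seq mul u v | u <- vbasis U, v <- vbasis V]>>%VS.

Lemma memv_mulv u v U V : u \in U -> v \in V -> mul u v \in mulv U V.
Proof.
move=> /coord_vbasis-> /coord_vbasis->.
rewrite linear_sumlz memv_suml // => i _; rewrite linear_sumr memv_suml // => j _.
rewrite linearZl_LR linearZr_LR !memvZ // memv_span //.
by apply/allpairsP; exists ((vbasis U)`_i, (vbasis V)`_j); rewrite /= !mem_nth ?size_tuple.
Qed.

Lemma mulvP U V W :
  reflect (forall u v, u \in U -> v \in V -> mul u v \in W) (mulv U V <= W)%VS.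
Proof.
apply: (iffP idP) => [/subvP sUVW u v Uu Vv | UVW]; first exact/sUVW/memv_mulv.
apply/span_subvP=> _ /allpairsP[[u v] /= [Uu Vv ->]].
by apply: UVW; apply: vbasis_mem.
Qed.

(* L^m, meaningful for m >= 1: L^1 = L and L^(m+1) = L^m L. *)
Definition lpow (m : nat) : {vspace L} := iter m.-1 (fun U => mulv U fullv) fullv.

Definition nilpotent := exists m, lpow m.+1 = 0%VS.

Definition center : {vspace L} :=
  (\bigcap_(e <- vbasis {:L}) lker (linfun (applyr mul e)))%VS.

Lemma mem_center u : reflect (forall v, mul u v = 0) (u \in center).
Proof.
apply: (iffP idP) => [Zu v | Zu].
  rewrite (coord_vbasis (memvf v)) linear_sumr big1 // => i _.
  rewrite linearZr_LR.
  have e_i : (vbasis {:L})`_i \in (vbasis {:L} : seq _) by rewrite mem_nth ?size_tuple.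
  move: Zu; rewrite /center (big_rem _ e_i) /= memv_cap memv_ker lfunE /= => /andP[/eqP-> _].
  by rewrite scaler0.
rewrite /center; elim: (tval _) => [|e s IHs]; first by rewrite big_nil memvf.
by rewrite big_cons memv_cap IHs andbT memv_ker lfunE /=; apply/eqP/Zu.
Qed.

Definition isotropic U := {in U &, forall u v, form u v = 0}.

(* The alternating form phi_z, written on representatives u, v of the classes
   u + L^2 and v + L^2. *)
Definition phi z u v : F := form (mul z u) v.

(* Non-degeneracy of phi_z on L/L^2: every class u + L^2 in the radical is zero.
   The condition z \notin center says that the class of z in L^2/Z(L) is
   non-zero. *)
Definition type_C :=
  [/\ nilpotent, \dim {:L} = 10, isotropic center, \dim center = 4
    & lpow 3 = center] /\
  (forall z, z \in lpow 2 -> z \notin center ->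
     forall u, (forall v, phi z u v = 0) -> u \in lpow 2).

End Subspaces.

Arguments lpow {F} L m.
Arguments center {F} L.

Definition isomorphic (F : fieldType) (L M : saa F) :=
  exists f : {linear L -> M},
    [/\ bijective f,
        forall u v, f (mul u v) = mul (f u) (f v)
      & forall u v, form (f u) (f v) = form u v].

Section Presentations.
Variables (F : fieldType) (n : nat).

(* inl i and inr i are the names of the basis vectors x_i and y_i. *)
Definition gen : finType := ('I_n + 'I_n)%type.

Definition standard_basis (L : saa F) (b : gen -> L) :=
  [/\ basis_of {:L} [seq b g | g : gen],
      forall i j, form (b (inl i)) (b (inl j)) = 0,
      forall i j, form (b (inr i)) (b (inr j)) = 0
    & forall i j, form (b (inl i)) (b (inr j)) = (i == j)%:R].

(* The entry ((g, h, k), a) stands for (g h, k) = a. *)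
Definition presentation := seq ((gen * gen * gen) * F).

Definition reordering (s t : gen * gen * gen) :=
  perm_eq [:: s.1.1; s.1.2; s.2] [:: t.1.1; t.1.2; t.2].

Definition has_presentation (L : saa F) (P : presentation) :=
  exists b : gen -> L,
    [/\ standard_basis b,
        forall g h k a, ((g, h, k), a) \in P -> form (mul (b g) (b h)) (b k) = a
      & forall g h k, ~~ has (fun e => reordering (g, h, k) e.1) P ->
          form (mul (b g) (b h)) (b k) = 0].

End Presentations.

(* x_ k and y_ k use the 1-based numbering k = 1, ..., 5. *)
Definition x_ (k : nat) : gen 5 := inl (inord k.-1).
Definition y_ (k : nat) : gen 5 := inr (inord k.-1).

Definition P10_44 (F : fieldType) (alpha beta : F) : presentation F 5 :=
  [:: ((x_ 1, y_ 2, y_ 3), 1);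
      ((x_ 1, y_ 3, y_ 4), alpha);
      ((x_ 1, y_ 4, y_ 5), beta);
      ((y_ 1, y_ 2, y_ 5), 1);
      ((y_ 1, y_ 3, y_ 4), 1)].

Definition irreducible_quadratic (F : fieldType) (alpha beta : F) :=
  irreducible_poly ('X^2 + alpha *: 'X + beta%:P : {poly F}).

(* Main.v *)
Require Import Defs.
From HB Require Import structures.
From mathcomp Require Import all_boot all_order all_algebra.
From mathcomp Require Import ring zify.
(* Imported again: the module sesquilinear has its own [form]. *)
Require Import Defs.
Set Implicit Arguments.
Unset Strict Implicit.
Unset Printing Implicit Defensive.
Import GRing.Theory.
Local Open Scope ring_scope.

(** Everything is read off the alternating trilinear form [(u v, w)].  By
    non-degeneracy the product can be recovered from it, so an algebra with a
    given presentation is unique up to isomorphism ([presentation_isomorphic]),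
    and every consistent presentation is realised by the algebra on
    [{ffun gen n -> F}] whose trilinear form it prescribes
    ([model_presentation]).

    Let [L] be of type C, [Z] its center and [L2] its square.  Since
    [Z = L2^perp], the form makes [L2 / Z] a symplectic plane; [L2] is abelian
    and [L2 L <= Z], so the trilinear form restricts to a linear map
    [z |-> phi_z] from that plane to the alternating forms on the 4-dimensional
    space [L / L2].  For a symplectic pair [x, y] of [L2] the Pfaffian of
    [s phi_x + t phi_y] is a binary quadratic form without non-trivial zeros.
    Bases of [L / L2] act on this Pfaffian through the determinant, that is by
    scalars; normalising its [t ^ 2] coefficient to 1 leaves
    [beta s ^ 2 + alpha s t + t ^ 2], which vanishes only at 0 exactly when
    [t ^ 2 + alpha t + beta] has no root.  The only freedom left is the choice
    of the symplectic pair, an element of SL(2, F), and substituting it in the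
    quadratic form gives the fractions of the theorem.

    Explicit vectors take the place of this Pfaffian.  For existence
    ([pencil_frame_exists]) one takes any [y2] outside [L2] and solves
    [y y4 = - x y2]; the plane spanned by [y2] and [y4] is isotropic for the
    whole pencil, and a complementary pair dual to it can be corrected to give
    the normal form.  The lifts of these vectors to [L] are then changed by
    multiples of [y] to kill the trilinear form on them ([frame_kill]) and by
    elements of [Z] to make them orthogonal ([frame_orthogonalize]); the
    products [y y_i] complete them to a standard basis ([frame_presents]).
    For the invariance, let [A] be the operator on [L / L2] with
    [phi_y (A u, v) = phi_x (u, v)]: it satisfies [A ^ 2 = alpha A - beta]
    ([P10_pencil]), a new pair replaces [A] by [(a A + b) / (c A + d)], and
    comparing the two quadratic equations on a single vector yields the new
    coefficients ([pencil_transform]).  Applied to the presentation that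
    [pair_presentation] attaches to a prescribed pair, the same computation
    shows that all the parameters of the theorem occur. *)

(** * The form and the trilinear form of an algebra *)

Local Notation tri u v w := (form (mul u v) w).

Section TrilinearForm.
Variables (F : fieldType) (L : saa F).
Implicit Types (u v w : L) (a : F).

Lemma formDl u v w : form (u + v) w = form u w + form v w.
Proof. exact: linearDl. Qed.
Lemma formDr u v w : form u (v + w) = form u v + form u w.
Proof. exact: linearD. Qed.
Lemma formZl a u v : form (a *: u) v = a * form u v.
Proof. exact: linearZl_LR. Qed.
Lemma formZr a u v : form u (a *: v) = a * form u v.
Proof. exact: linearZr_LR. Qed.
Lemma formNl u v : form (- u) v = - form u v.
Proof. exact: linearNl. Qed.
Lemma formNr u v : form u (- v) = - form u v.
Proof. exact: linearN. Qed.
Lemma form0l u : form 0 u = 0.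
Proof. exact: linear0l. Qed.
Lemma form0r u : form u 0 = 0.
Proof. exact: linear0. Qed.
Lemma lmulDl u v w : mul (u + v) w = mul u w + mul v w.
Proof. exact: linearDl. Qed.
Lemma lmulDr u v w : mul u (v + w) = mul u v + mul u w.
Proof. exact: linearD. Qed.
Lemma lmulZl a u v : mul (a *: u) v = a *: mul u v.
Proof. exact: linearZl_LR. Qed.
Lemma lmulZr a u v : mul u (a *: v) = a *: mul u v.
Proof. exact: linearZr_LR. Qed.
Lemma lmulNl u v : mul (- u) v = - mul u v.
Proof. exact: linearNl. Qed.
Lemma lmulNr u v : mul u (- v) = - mul u v.
Proof. exact: linearN. Qed.
Lemma lmul0l u : mul 0 u = 0.
Proof. exact: linear0l. Qed.
Lemma lmul0r u : mul u 0 = 0.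
Proof. exact: linear0. Qed.

Definition bilE := (formDl, formDr, formZl, formZr, formNl, formNr, form0l, form0r,
  lmulDl, lmulDr, lmulZl, lmulZr, lmulNl, lmulNr, lmul0l, lmul0r).

Lemma formC u v : form v u = - form u v.
Proof.
have := form_alt (u + v); rewrite !bilE !form_alt add0r addr0 => /eqP.
by rewrite addrC addr_eq0 => /eqP.
Qed.

Lemma lmulC u v : mul v u = - mul u v.
Proof.
have := mul_alt (u + v); rewrite !bilE !mul_alt add0r addr0 => /eqP.
by rewrite addrC addr_eq0 => /eqP.
Qed.

Lemma triC u v w : tri v u w = - tri u v w.
Proof. by rewrite lmulC formNl. Qed.

Lemma triR u v w : tri v w u = tri u v w.
Proof. by rewrite -form_mul. Qed.

Lemma triCr u v w : tri u w v = - tri u v w.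
Proof. by rewrite -(triR u w v) triC triR. Qed.

Lemma form_inj u v : (forall w, form u w = form v w) -> u = v.
Proof.
move=> E; apply/eqP; rewrite -subr_eq0; apply/eqP/form_nondeg => w.
by rewrite !bilE E subrr.
Qed.

(** Non-degeneracy makes [u |-> form u] injective into the dual space, which
    has the same dimension; functionals are encoded by their values on a basis. *)
Lemma riesz (f : {scalar L}) : exists u, form u =1 f.
Proof.
pose n := \dim {:L}; pose e := vbasis {:L}.
have ext (g h : {scalar L}) : (forall j : 'I_n, g e`_j = h e`_j) -> g =1 h.
  move=> E u; rewrite (coord_vbasis (memvf u)) !linear_sum; apply: eq_bigr => i _.
  by rewrite !linearZ E.
pose D u : 'rV[F]_n := \row_j form u e`_j.
have D_lin : linear D by move=> a u v; apply/rowP=> j; rewrite !mxE !bilE.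
pose D' := linfun (HB.pack D (GRing.isLinear.Build _ _ _ _ D D_lin) : {linear L -> 'rV_n}).
have kD : lker D' == 0%VS.
  rewrite -subv0; apply/subvP=> u; rewrite memv_ker lfunE memv0 => /eqP/rowP Du.
  apply/eqP/form_nondeg; apply: (ext _ \0) => j.
  by have := Du j; rewrite !mxE.
have /vspaceP/(_ (\row_j f e`_j)) : (limg D' = fullv).
  apply/eqP; rewrite eqEdim subvf limg_dim_eq ?(eqP kD) ?capv0 //.
  by rewrite !dimvf /= [leqLHS](mul1n n) /n dimvf.
rewrite memvf => /memv_imgP[u _ E]; exists u; apply: ext => j.
by move/rowP: E => /(_ j); rewrite lfunE !mxE.
Qed.

(** The dual family represents the coordinate functionals of [X]. *)
Lemma dual_family k (X : k.-tuple L) :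
  free X -> exists Y : 'I_k -> L, forall i j : 'I_k, form (Y i) X`_j = (i == j)%:R.
Proof.
move=> fX; have /fin_all_exists[Y EY] i : exists u, form u =1 (coord X i : {scalar L}).
  exact: riesz.
by exists Y => i j; rewrite EY [LHS](coord_free j i fX) eq_sym.
Qed.

(** Pairing with a basis of [U] is a map onto [F ^ dim U] by [dual_family],
    and its kernel is [V]. *)
Lemma dim_orthogonal (U V : {vspace L}) :
  (forall v, v \in V <-> forall u, u \in U -> form u v = 0) ->
  (\dim U + \dim V = \dim {:L})%N.
Proof.
move=> VE; pose X := vbasis U; have [D DX] := dual_family (basis_free (vbasisP U)).
pose f v : 'rV[F]_(\dim U) := \row_j form X`_j v.
have f_lin : linear f by move=> a u v; apply/rowP=> j; rewrite !mxE !bilE.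
pose f' := linfun (HB.pack f (GRing.isLinear.Build _ _ _ _ f f_lin) : {linear L -> 'rV_(\dim U)}).
have -> : V = lker f'.
  apply/vspaceP=> v; rewrite memv_ker lfunE; apply/idP/eqP => /= [/VE Uv | /rowP fv].
    by apply/rowP=> j; rewrite !mxE Uv // vbasis_mem // mem_nth // size_tuple.
  apply/VE=> u /coord_vbasis ->; rewrite linear_sumlz big1 // => i _.
  by have := fv i; rewrite !mxE formZl => ->; rewrite mulr0.
have : limg f' = fullv.
  apply/vspaceP=> r; rewrite memvf; apply/memv_imgP.
  exists (\sum_i (- r 0 i) *: D i); first exact: memvf.
  apply/rowP=> j; rewrite lfunE !mxE linear_sum (bigD1 j) //= big1 => [|i nij].
    by rewrite formZr formC DX eqxx addr0 mulNr mulrN opprK mulr1.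
  by rewrite formZr formC DX (negPf nij) oppr0 mulr0.
move=> fE; have := limg_ker_dim f' fullv; rewrite capfv fE => <-.
by rewrite addnC; congr addn; rewrite dimvf /dim /= mul1n.
Qed.
End TrilinearForm.

(** * Alternating functions of three arguments *)

(** The symmetric group on three letters is generated by a transposition and
    a 3-cycle. *)
Lemma perm3_ind (T : eqType) (R : T -> T -> T -> Prop) :
    (forall g h k, R g h k -> R h g k) -> (forall g h k, R g h k -> R h k g) ->
  forall g h k g' h' k',
    perm_eq [:: g; h; k] [:: g'; h'; k'] -> R g' h' k' -> R g h k.
Proof.
move=> RC RR.
have R6 g h k : R g h k -> [/\ R h g k, R h k g, R k h g, R k g h & R g k h].
  by move=> r; split; auto.
have perm2 (x y x' y' : T) : perm_eq [:: x; y] [:: x'; y'] ->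
   x = x' /\ y = y' \/ x = y' /\ y = x'.
  move=> p; have : x \in [:: x'; y'] by rewrite -(perm_mem p) mem_head.
  rewrite !inE => /orP[]/eqP e; subst.
    by left; move: p; rewrite perm_cons => /perm_small_eq -/(_ isT) [].
  right; move: p; rewrite (perm_sym _ [:: x'; _]) (perm_catC [:: x'] [:: y']) /=.
  by rewrite perm_sym perm_cons => /perm_small_eq -/(_ isT) [].
move=> g h k g' h' k' p /[dup] r /R6[r1 r2 r3 r4 r5].
have : g \in [:: g'; h'; k'] by rewrite -(perm_mem p) mem_head.
rewrite !inE => /or3P[]/eqP e; subst g.
- by move: p; rewrite perm_cons => /perm2 [[-> ->]|[-> ->]].
- move: p; rewrite perm_sym (perm_catCA [:: g'] [:: h'] [:: k']) perm_sym perm_cons.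
  by move=> /perm2 [[-> ->]|[-> ->]].
move: p; rewrite perm_sym (perm_catC [:: g'; h'] [:: k']) perm_sym perm_cons.
by move=> /perm2 [[-> ->]|[-> ->]].
Qed.

(** The exterior product of three functionals, evaluated at [(u, v, w)]. *)
Definition wedge3 (F : comNzRingType) (V : Type) (f g h : V -> F) u v w : F :=
  f u * (g v * h w - g w * h v) - f v * (g u * h w - g w * h u)
  + f w * (g u * h v - g v * h u).

(** Each of the six terms of the expansion is a product of three Kronecker
    symbols, which is non-zero only if it matches the two triples. *)
Lemma wedge3_delta (F : comNzRingType) (T : eqType)
    (d := fun x y : T => (x == y)%:R : F) g h k g' h' k' :
  ~~ perm_eq [:: g'; h'; k'] [:: g; h; k] ->
  wedge3 (d g) (d h) (d k) g' h' k' = 0.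
Proof.
move=> np.
have z a b c : perm_eq [:: g'; h'; k'] [:: a; b; c] -> d g a * (d h b * d k c) = 0.
  move=> p; rewrite /d; case: eqP np => [->|_] np; last by rewrite mul0r.
  case: eqP np => [->|_] np; last by rewrite mul0r mulr0.
  by case: eqP np => [->|_] np; rewrite ?p // in np; rewrite !mulr0.
rewrite /wedge3 !mulrBr !z ?subrr ?addr0 //; apply/permP => p /=; lia.
Qed.

(** * Presentations as formulas for the trilinear form *)

Section Presents.
Variables (F : fieldType) (n : nat).
Implicit Types (L : saa F) (P : presentation F n) (g h k : gen n).

(** The body of [has_presentation], for a given basis. *)
Definition presents L (b : gen n -> L) P :=
  [/\ standard_basis b,
      forall g h k a, ((g, h, k), a) \in P -> tri (b g) (b h) (b k) = a
    & forall g h k, ~~ has (fun e => reordering (g, h, k) e.1) P ->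
        tri (b g) (b h) (b k) = 0].

Definition gram L (b : gen n -> L) :=
  [/\ forall i j, form (b (inl i)) (b (inl j)) = 0,
      forall i j, form (b (inr i)) (b (inr j)) = 0
    & forall i j, form (b (inl i)) (b (inr j)) = (i == j)%:R].

(** The coordinate of [u] on [b g] when [b] is a standard basis. *)
Definition coordg L (b : gen n -> L) g u : F :=
  match g with inl i => form u (b (inr i)) | inr i => form (b (inl i)) u end.

(** The alternating trilinear form prescribed by [P] in the coordinates of [b]. *)
Definition ptri L (b : gen n -> L) P u v w : F :=
  \sum_(e <- P) e.2 * wedge3 (coordg b e.1.1.1) (coordg b e.1.1.2) (coordg b e.1.2) u v w.

(** An entry with a repeated generator, or two entries that are reorderings of
    each other, could prescribe contradictory values. *)
Definition consistent P :=
  all (fun e => uniq [:: e.1.1.1; e.1.1.2; e.1.2]) P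
  && pairwise (fun e e' => ~~ reordering e.1 e'.1) P.

Section Coordinates.
Variables (L : saa F) (b : gen n -> L).
Implicit Types u v w : L.

Lemma coordg_lin g : scalar (coordg b g).
Proof. by case: g => i a u v /=; rewrite !bilE. Qed.
HB.instance Definition _ g := GRing.isLinear.Build F L F _ (coordg b g) (coordg_lin g).

Lemma coordg_basis : gram b -> forall g h, coordg b g (b h) = (g == h)%:R.
Proof.
by case=> xx yy xy [i|i] [j|j] /=; rewrite ?xx ?yy ?xy // eq_sym.
Qed.

Lemma coordg_comb c g : gram b -> coordg b g (\sum_h c h *: b h) = c g.
Proof.
move=> gr; rewrite linear_sum (bigD1 g) //= linearZ /= coordg_basis // eqxx mulr1.
rewrite big1 ?addr0 // => h ngh.
by rewrite linearZ /= coordg_basis // eq_sym (negPf ngh) mulr0.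
Qed.

Lemma gram_free : gram b -> free [seq b g | g : gen n].
Proof.
move=> gr; have -> : [seq b g | g : gen n] = image_tuple b predT by [].
apply/freeP => c c0 i; have := coordg_comb (fun g => c (enum_rank g)) (enum_val i) gr.
rewrite enum_valK => <-; transitivity (coordg b (enum_val i) 0); last exact: linear0.
rewrite -[X in _ = coordg b _ X]c0; congr coordg.
rewrite (reindex (fun i : 'I_#|gen n| => enum_val i)) /=;
  last exact: onW_bij (enum_val_bij _).
by apply: eq_bigr => j _; rewrite enum_valK nth_image.
Qed.

Lemma gram_dim_basis : gram b -> \dim {:L} = (n + n)%N -> standard_basis b.
Proof.
move=> gr dimL; have [xx yy xy] := gr; split=> //.
by rewrite basisEfree gram_free // subvf dimL size_image card_sum !card_ord leqnn.
Qed.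

Lemma gram_span_basis :
  gram b -> (forall u, exists c, u = \sum_g c g *: b g) -> standard_basis b.
Proof.
move=> gr sp; have [xx yy xy] := gr; split=> //.
rewrite /basis_of gram_free // andbT eqEsubv subvf; apply/subvP=> u _.
have [c ->] := sp u; apply: memv_suml => g _; apply/memvZ/memv_span.
by apply: map_f; rewrite mem_enum.
Qed.

Lemma standard_gram : standard_basis b -> gram b.
Proof. by case=> _ *; split. Qed.

Lemma coordg_sum u : standard_basis b -> u = \sum_g coordg b g u *: b g.
Proof.
move=> sb; have gr := standard_gram sb; have [/span_basis bs _ _ _] := sb.
have : u \in <<[seq b g | g : gen n]>>%VS by rewrite bs memvf.
have -> : [seq b g | g : gen n] = image_tuple b predT by [].
move=> /coord_span E; pose c i := coord (image_tuple b predT) i u.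
have {}E : u = \sum_g c (enum_rank g) *: b g.
  rewrite [LHS]E (reindex (fun i : 'I_#|gen n| => enum_val i)) /=;
    last exact: onW_bij (enum_val_bij _).
  by apply: eq_bigr => j _; rewrite enum_valK nth_image.
by rewrite [LHS]E; apply: eq_bigr => g _; rewrite E coordg_comb.
Qed.

Lemma coordg_inj u v : standard_basis b -> (forall g, coordg b g u = coordg b g v) -> u = v.
Proof.
move=> sb E; rewrite (coordg_sum u sb) (coordg_sum v sb).
by apply: eq_bigr => g _; rewrite E.
Qed.

Lemma form_coordg u v : standard_basis b ->
  form u v = \sum_i (coordg b (inl i) u * coordg b (inr i) v
                     - coordg b (inr i) u * coordg b (inl i) v).
Proof.
move=> sb; rewrite {1}(coordg_sum v sb) linear_sum big_sumType /= sumrB -sumrN addrC.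
congr (_ + _); apply: eq_bigr => i _; rewrite linearZ /= mulrC //.
by rewrite formC mulNr.
Qed.

Section Tri.
Variable P : presentation F n.

Lemma ptri_cyc u v w : ptri b P v w u = ptri b P u v w.
Proof. by apply: eq_bigr => e _; rewrite /wedge3; ring. Qed.

Lemma ptriC u v w : ptri b P v u w = - ptri b P u v w.
Proof. by rewrite -sumrN; apply: eq_bigr => e _; rewrite /wedge3; ring. Qed.

Lemma ptri_lin v w : scalar (fun u => ptri b P u v w).
Proof.
move=> a u u'; rewrite /ptri [a * _]mulr_sumr -big_split; apply: eq_bigr => e _ /=.
by rewrite /wedge3 !linearP /=; ring.
Qed.

Lemma ptri_sum u v w : standard_basis b ->
  ptri b P u v w = \sum_g coordg b g u * ptri b P (b g) v w.
Proof.
move=> sb; rewrite {1}(coordg_sum u sb).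
pose f : {scalar L} := HB.pack (fun u => ptri b P u v w)
   (GRing.isLinear.Build _ _ _ _ _ (ptri_lin v w)).
rewrite -[LHS]/(f _) linear_sum; apply: eq_bigr => g _; exact: linearZ.
Qed.

Lemma tri_sum u v w : standard_basis b ->
  tri u v w = \sum_g coordg b g u * tri (b g) v w.
Proof.
move=> sb; rewrite -triR {1}(coordg_sum u sb) linear_sum; apply: eq_bigr => g _.
by rewrite linearZ /= triR.
Qed.

Lemma tri_ptri : standard_basis b ->
  (forall g h k, tri (b g) (b h) (b k) = ptri b P (b g) (b h) (b k)) ->
  forall u v w, tri u v w = ptri b P u v w.
Proof.
move=> sb E u v w; rewrite tri_sum // ptri_sum //; apply: eq_bigr => g _.
congr (_ * _); rewrite -triR -ptri_cyc tri_sum // ptri_sum //; apply: eq_bigr => h _.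
congr (_ * _); rewrite -triR -ptri_cyc tri_sum // ptri_sum //; apply: eq_bigr => k _.
by rewrite -triR -ptri_cyc E.
Qed.

Lemma wedge3_basis g h k g' h' k' : gram b ->
  wedge3 (coordg b g) (coordg b h) (coordg b k) (b g') (b h') (b k')
  = wedge3 (fun x => (g == x)%:R) (fun x => (h == x)%:R) (fun x => (k == x)%:R) g' h' k'.
Proof. by move=> gr; rewrite /wedge3 !coordg_basis. Qed.

Lemma ptri_other g h k : gram b -> ~~ has (fun e => reordering (g, h, k) e.1) P ->
  ptri b P (b g) (b h) (b k) = 0.
Proof.
move=> gr /hasPn nP; rewrite /ptri big1_seq // => e /= /nP np.
by rewrite wedge3_basis // wedge3_delta ?mulr0.
Qed.

Lemma ptri_entry g h k a : gram b -> consistent P -> ((g, h, k), a) \in P ->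
  ptri b P (b g) (b h) (b k) = a.
Proof.
move=> gr /andP[/allP uP pw] Pe; have /= := uP _ Pe.
rewrite !inE negb_or andbT => /andP[/andP[gh gk] hk].
case/splitPr: Pe pw {uP} => P1 P2.
rewrite pairwise_cat /= allrel_consr => /and4P[/andP[nP1 _] _ nP2 _].
rewrite /ptri big_cat big_cons /= wedge3_basis //.
rewrite !big1_seq ?add0r ?addr0 => [|e /= /(allP nP2) np|e /= /(allP nP1) np].
- rewrite /wedge3 !eqxx (negPf gh) (negPf gk) (negPf hk) (eq_sym h g) (eq_sym k g).
  by rewrite (negPf gh) (negPf gk) /=; ring.
- by rewrite wedge3_basis // wedge3_delta ?mulr0.
- by rewrite wedge3_basis // wedge3_delta ?mulr0 // perm_sym.
Qed.

(** Listed values and zeros elsewhere determine the trilinear form, because it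
    is alternating: a triple of basis vectors is either a reordering of a listed
    one or a zero. *)
Lemma presentsP : consistent P ->
  presents b P <-> standard_basis b /\ forall u v w, tri u v w = ptri b P u v w.
Proof.
move=> cP; split=> [[sb entry other]|[sb E]]; have gr := standard_gram sb; last first.
  split=> // g h k; first by move=> a ghk; rewrite E (ptri_entry gr cP ghk).
  by move=> nP; rewrite E ptri_other.
split=> //; apply: tri_ptri => // g h k.
case: (boolP (has (fun e => reordering (g, h, k) e.1) P)) => [|nP]; last first.
  by rewrite other ?ptri_other //.
case/hasP=> -[[[g' h'] k'] a] Pe /=; rewrite /reordering /= => p.
apply: (perm3_ind (R := fun g h k => tri (b g) (b h) (b k) = ptri b P (b g) (b h) (b k))) p _.
- by move=> ? ? ? E; rewrite triC E -ptriC.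
- by move=> ? ? ? E; rewrite triR E -ptri_cyc.
- by rewrite (entry _ _ _ _ Pe) (ptri_entry gr cP Pe).
Qed.
End Tri.
End Coordinates.

Lemma isomorphic_sym L L' : isomorphic L L' -> isomorphic L' L.
Proof.
case=> f [[g fK gK] fm ff].
exists (HB.pack g (GRing.isLinear.Build _ _ _ _ g (can2_linear fK gK)) : {linear L' -> L}).
split=> /=; first by exists f.
  by move=> u v; apply: (can_inj fK); rewrite fm !gK.
by move=> u v; rewrite -ff !gK.
Qed.

Lemma isomorphic_presentation L L' P :
  isomorphic L L' -> has_presentation L P -> has_presentation L' P.
Proof.
move=> [f [[g fK gK] fm ff]] [b [sb entry other]].
exists (f \o b); split=> [|x y z a|x y z] /=; rewrite -?fm ?ff; [|exact: entry|exact: other].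
apply: gram_span_basis.
  by have [xx yy xy] := standard_gram sb; split=> i j /=; rewrite ff.
move=> u; exists (fun x => coordg b x (g u)).
by rewrite -{1}(gK u) {1}(coordg_sum (g u) sb) linear_sum; apply: eq_bigr => x _; rewrite linearZ.
Qed.

(** The linear map matching the two bases preserves the form and the trilinear
    form, hence the product. *)
Lemma presentation_isomorphic L L' P : consistent P ->
  has_presentation L P -> has_presentation L' P -> isomorphic L L'.
Proof.
move=> cP [b /(presentsP _ cP)[sb E]] [b' /(presentsP _ cP)[sb' E']].
have [gr gr'] := (standard_gram sb, standard_gram sb').
pose f u := \sum_g coordg b g u *: b' g.
pose f' u := \sum_g coordg b' g u *: b g.
have fK : cancel f f'.
  by move=> u; rewrite [RHS](coordg_sum u sb); apply: eq_bigr => g _; rewrite coordg_comb.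
have f'K : cancel f' f.
  by move=> u; rewrite [RHS](coordg_sum u sb'); apply: eq_bigr => g _; rewrite coordg_comb.
have f_lin : linear f.
  move=> a u v; apply: (coordg_inj sb') => g.
  by rewrite linearP /= !coordg_comb // linearP.
have ff u v : form (f u) (f v) = form u v.
  rewrite (form_coordg _ _ sb) (form_coordg _ _ sb'); apply: eq_bigr => i _.
  by rewrite !coordg_comb.
exists (HB.pack f (GRing.isLinear.Build _ _ _ _ f f_lin) : {linear L -> L'}); split=> //=.
  by exists f'.
move=> u v; apply: form_inj => w; rewrite -(f'K w) ff E E'.
by apply: eq_bigr => e _; rewrite /wedge3 !coordg_comb.
Qed.
End Presents.

(** * The algebra defined by a presentation *)

Section Model.
Variables (F : fieldType) (n : nat) (P : presentation F n).
Local Notation M := {ffun gen n -> F^o}.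
Implicit Types (u v w : M) (g : gen n).

Definition unit_vec g : M := [ffun h => (g == h)%:R].

Definition model_form u v : F :=
  \sum_i (u (inl i) * v (inr i) - u (inr i) * v (inl i)).

Definition model_tri u v w : F :=
  \sum_(e <- P)
    e.2 * wedge3 (fun x : M => x e.1.1.1) (fun x => x e.1.1.2) (fun x => x e.1.2) u v w.

(** The coordinates of [mul u v] are its pairings with the dual basis vectors,
    hence values of the trilinear form; the sign is that of [(y_i, x_i) = -1]. *)
Definition model_mul u v : M :=
  [ffun g => match g with
             | inl i => model_tri u v (unit_vec (inr i))
             | inr i => - model_tri u v (unit_vec (inl i)) end].

Lemma model_form_bilinear : bilinear_for *%R *%R model_form.
Proof.
split=> v a u w; rewrite /model_form /= mulr_sumr -big_split; apply: eq_bigr => i _ /=;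
  by rewrite !ffunE /GRing.scale /=; ring.
Qed.
HB.instance Definition _ := bilinear_isBilinear.Build F M M F _ _ model_form model_form_bilinear.

Lemma model_tri_cyc u v w : model_tri v w u = model_tri u v w.
Proof. by apply: eq_bigr => e _; rewrite /wedge3; ring. Qed.

Lemma model_tri_lin v w : scalar (fun u => model_tri u v w).
Proof.
move=> a u u'; rewrite /model_tri [a * _]mulr_sumr -big_split; apply: eq_bigr => e _ /=.
by rewrite /wedge3 !ffunE /GRing.scale /=; ring.
Qed.

Lemma model_mul_bilinear : bilinear_for *:%R *:%R model_mul.
Proof.
have lin1 a u u' v w : model_tri (a *: u + u') v w = a * model_tri u v w + model_tri u' v w.
  exact: model_tri_lin.
have lin2 a u v v' w : model_tri u (a *: v + v') w = a * model_tri u v w + model_tri u v' w.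
  by rewrite -!(model_tri_cyc u) lin1.
split=> v a u w; apply/ffunP=> -[i|i]; rewrite !ffunE /= ?lin1 ?lin2 /GRing.scale //=; ring.
Qed.
HB.instance Definition _ := bilinear_isBilinear.Build F M M M _ _ model_mul model_mul_bilinear.

Lemma ffun_sum_unit_vec u : u = \sum_g u g *: unit_vec g.
Proof.
apply/ffunP=> h; rewrite sum_ffunE (bigD1 h) //= !ffunE eqxx big1 => [|g ngh].
  by rewrite addr0 /GRing.scale /= mulr1.
by rewrite !ffunE (negPf ngh) scaler0.
Qed.

Lemma scalar_unit_vec (f : M -> F) u : scalar f -> f u = \sum_g u g * f (unit_vec g).
Proof.
move=> f_lin; pose f' : {scalar M} := HB.pack f (GRing.isLinear.Build _ _ _ _ _ f_lin).
rewrite -[LHS]/(f' u) [in LHS](ffun_sum_unit_vec u) linear_sum; apply: eq_bigr => g _.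
exact: linearZ.
Qed.

Lemma model_form_mul u v w : model_form (model_mul u v) w = model_tri u v w.
Proof.
rewrite -2!model_tri_cyc (scalar_unit_vec w (model_tri_lin u v)) big_sumType /= -big_split.
apply: eq_bigr => i _ /=; rewrite !ffunE !(model_tri_cyc _ u v); ring.
Qed.

Lemma model_form_inr u i : model_form u (unit_vec (inr i)) = u (inl i).
Proof.
rewrite /model_form (bigD1 i) //= !ffunE eqxx mulr1 mulr0 subr0 big1 ?addr0 // => j nji.
by rewrite !ffunE -[inr i == inr j]/(i == j) (eq_sym i) (negPf nji) !mulr0 subr0.
Qed.

Lemma model_form_inl u i : model_form u (unit_vec (inl i)) = - u (inr i).
Proof.
rewrite /model_form (bigD1 i) //= !ffunE eqxx mulr1 mulr0 sub0r big1 ?addr0 // => j nji.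
by rewrite !ffunE -[inl i == inl j]/(i == j) (eq_sym i) (negPf nji) !mulr0 subr0.
Qed.

Definition model : saa F.
Proof.
apply: (@SAA F M model_form model_mul).
- by move=> u; rewrite /= /model_form big1 // => i _; rewrite mulrC subrr.
- move=> u u0; apply/ffunP=> -[i|i]; rewrite ffunE.
    by rewrite -model_form_inr; apply: u0.
  by apply: oppr_inj; rewrite oppr0 -model_form_inl; apply: u0.
- move=> u; apply/ffunP=> g; rewrite !ffunE.
  have t0 w : model_tri u u w = 0 by rewrite /model_tri big1 // => e _; rewrite /wedge3; ring.
  by case: g => i; rewrite t0 ?oppr0.
- move=> u v w /=; rewrite !model_form_mul; exact/esym/model_tri_cyc.
Defined.

Lemma model_presentation : consistent P -> has_presentation model P.
Proof.
move=> cP; exists (unit_vec : gen n -> model); apply/(presentsP _ cP).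
have c g u : coordg (unit_vec : gen n -> model) g u = u g.
  case: g => i /=; first exact: model_form_inr.
  by have := @formC F model u (unit_vec (inl i)); rewrite /= model_form_inl opprK.
split.
  apply: gram_span_basis; last by move=> u; exists u; exact: ffun_sum_unit_vec.
  by split=> i j; rewrite [form _ _]/= ?model_form_inl ?model_form_inr !ffunE ?oppr0.
move=> u v w; rewrite [LHS]model_form_mul; apply: eq_bigr => e _.
by rewrite /wedge3 !c.
Qed.
End Model.

(** * Generators and coordinate subspaces *)

(* Coordinates are kept folded: they are the atoms of the polynomial identities. *)
Arguments coordg : simpl never.

Lemma x_eq (j k : nat) : (0 < j <= 5)%N -> (0 < k <= 5)%N -> (x_ j == x_ k) = (j == k).
Proof.
move=> jn kn; rewrite -[LHS]/(inord j.-1 == inord k.-1 :> 'I_5) -val_eqE /= !inordK; lia.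
Qed.
Lemma y_eq (j k : nat) : (0 < j <= 5)%N -> (0 < k <= 5)%N -> (y_ j == y_ k) = (j == k).
Proof.
move=> jn kn; rewrite -[LHS]/(inord j.-1 == inord k.-1 :> 'I_5) -val_eqE /= !inordK; lia.
Qed.
Lemma gen5P (Q : gen 5 -> Prop) :
  Q (x_ 1) -> Q (y_ 1) -> Q (x_ 2) -> Q (x_ 3) -> Q (x_ 4) -> Q (x_ 5) ->
  Q (y_ 2) -> Q (y_ 3) -> Q (y_ 4) -> Q (y_ 5) -> forall g, Q g.
Proof.
move=> q1 q2 q3 q4 q5 q6 q7 q8 q9 q10; have e i k : val i = k -> i = inord k :> 'I_5.
  by move=> <-; rewrite inord_val.
case=> -[[|[|[|[|[|//]]]]] i5]; rewrite (e (Ordinal i5) _ erefl); assumption.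
Qed.

Lemma P10_consistent (F : fieldType) (alpha beta : F) : consistent (P10_44 alpha beta).
Proof.
have E k (k5 : (k < 5)%N) : inord k = Ordinal k5 by apply: val_inj; rewrite /= inordK.
by rewrite /P10_44 /x_ /y_ !(E 0 isT) !(E 1 isT) !(E 2 isT) !(E 3 isT) !(E 4 isT).
Qed.
Section SpanBasis.
Variables (F : fieldType) (n : nat) (L : saa F) (b : gen n -> L).
Hypothesis sb : standard_basis b.

Lemma mem_span_basis (s : seq (gen n)) u :
  reflect (forall g, g \notin s -> coordg b g u = 0) (u \in <<[seq b g | g <- s]>>%VS).
Proof.
apply: (iffP idP) => [us g gs | us].
  suff /subvP/(_ u us) : (<<[seq b g | g <- s]>> <= lker (linfun (coordg b g : L -> F^o)))%VS.
    by rewrite memv_ker lfunE => /eqP.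
  apply/span_subvP=> _ /mapP[h hs ->].
  rewrite memv_ker lfunE /= coordg_basis; last exact: standard_gram.
  by have [E|_] := eqVneq g h; rewrite ?mulr0n // E hs in gs *.
rewrite (coordg_sum u sb); apply: memv_suml => g _.
have [gs|/us->] := boolP (g \in s); last by rewrite scale0r mem0v.
by apply/memvZ/memv_span/map_f.
Qed.

Lemma dim_span_basis (s : seq (gen n)) : uniq s -> \dim <<[seq b g | g <- s]>>%VS = size s.
Proof.
move=> us; have fs : free [seq b g | g <- s].
  have := gram_free (standard_gram sb).
  have p : perm_eq ([seq g <- enum (gen n) | g \in s] ++ [seq g <- enum (gen n) | g \notin s])
                   (enum (gen n)) by exact/permPl/(perm_filterC (mem s)).
  rewrite -(perm_free (perm_map b p)) map_cat => /catl_free; congr is_true.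
  apply/perm_free/perm_map/uniq_perm => // [|g]; first exact/filter_uniq/enum_uniq.
  by rewrite mem_filter mem_enum andbT.
by rewrite (eqP fs) size_map.
Qed.
End SpanBasis.

(** * The algebras presented by P10_44 *)

Section Quadratic.
Variables (F : fieldType) (alpha beta : F).

Lemma quadratic_noroot :
  irreducible_quadratic alpha beta <-> forall t, t ^+ 2 + alpha * t + beta != 0.
Proof.
rewrite /irreducible_quadratic -addrA; set p := 'X^2 + _.
have sz : size p = 3.
  rewrite size_polyDl size_polyXn // (leq_ltn_trans (size_polyD _ _)) // gtn_max.
  rewrite (leq_ltn_trans (size_scale_leq _ _)) ?size_polyX //.
  exact: leq_ltn_trans (size_polyC_leq1 _) _.
have ev t : p.[t] = t ^+ 2 + alpha * t + beta by rewrite /p !hornerE ?addrA.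
split=> [[_ irr] t | nr]; last first.
  by apply: cubic_irreducible => [|t]; rewrite ?sz // /root ev.
apply/eqP=> pt; have : ('X - t%:P) %= p.
  by apply: irr; rewrite ?size_XsubC // dvdp_XsubCl /root ev pt.
by move/eqp_size; rewrite size_XsubC sz.
Qed.

(** The left-hand side is the Pfaffian of [s phi_x + t phi_y], the homogeneous
    form of [t ^ 2 + alpha t + beta]. *)
Lemma pfaffian_neq0 s t : irreducible_quadratic alpha beta ->
  beta * s ^+ 2 + alpha * s * t + t ^+ 2 = 0 -> s = 0 /\ t = 0.
Proof.
move=> /quadratic_noroot nr; have [->|s0] := eqVneq s 0.
  by rewrite expr0n /= !(mulr0, mul0r, add0r) => /eqP; rewrite expf_eq0 => /eqP.
move=> E; have /eqP[] := nr (t / s); apply: (mulfI (expf_neq0 2 s0)).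
by rewrite mulr0 -[RHS]E; field.
Qed.
End Quadratic.

Section FromPresentation.
Variables (F : fieldType) (L : saa F) (alpha beta : F) (b : gen 5 -> L).
Hypothesis bP : presents b (P10_44 alpha beta).
Local Notation X k := (b (x_ k)).
Local Notation Y k := (b (y_ k)).
Local Notation c := (coordg b).
Implicit Types u v w : L.

Let sb : standard_basis b. Proof. by case: bP. Qed.
Let gr : gram b := standard_gram sb.

Lemma P10_triE u v w : tri u v w =
    wedge3 (c (x_ 1)) (c (y_ 2)) (c (y_ 3)) u v w
  + alpha * wedge3 (c (x_ 1)) (c (y_ 3)) (c (y_ 4)) u v w
  + beta * wedge3 (c (x_ 1)) (c (y_ 4)) (c (y_ 5)) u v w
  + wedge3 (c (y_ 1)) (c (y_ 2)) (c (y_ 5)) u v w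
  + wedge3 (c (y_ 1)) (c (y_ 3)) (c (y_ 4)) u v w.
Proof.
have /(presentsP _ (P10_consistent alpha beta))[_ ->] := bP.
by rewrite /ptri !big_cons big_nil /= !mul1r addr0 !addrA.
Qed.

Lemma coord_xx (j k : nat) :
  (0 < j <= 5)%N -> (0 < k <= 5)%N -> c (x_ j) (X k) = (j == k)%:R.
Proof. by move=> jn kn; rewrite coordg_basis // x_eq. Qed.
Lemma coord_yy (j k : nat) :
  (0 < j <= 5)%N -> (0 < k <= 5)%N -> c (y_ j) (Y k) = (j == k)%:R.
Proof. by move=> jn kn; rewrite coordg_basis // y_eq. Qed.
Lemma coord_xy (j k : nat) : c (x_ j) (Y k) = 0.
Proof. by rewrite coordg_basis. Qed.
Lemma coord_yx (j k : nat) : c (y_ j) (X k) = 0.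
Proof. by rewrite coordg_basis. Qed.

Lemma coordD g u v : c g (u + v) = c g u + c g v. Proof. exact: linearD. Qed.
Lemma coordN g u : c g (- u) = - c g u. Proof. exact: linearN. Qed.
Lemma coordZ g a u : c g (a *: u) = a * c g u. Proof. exact: linearZ. Qed.

Definition coordE := (coordD, coordN, coordZ, coord_xy, coord_yx).

Local Ltac crd := rewrite P10_triE /wedge3 ?coordE ?coord_xx ?coord_yy //=; try ring.

Lemma form_x k u : form (X k) u = c (y_ k) u. Proof. by []. Qed.
Lemma form_y k u : form (Y k) u = - c (x_ k) u. Proof. by rewrite formC. Qed.

Lemma mul_y1y2 : mul (Y 1) (Y 2) = X 5.
Proof. by apply: form_inj => w; rewrite form_x; crd. Qed.
Lemma mul_y1y3 : mul (Y 1) (Y 3) = X 4.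
Proof. by apply: form_inj => w; rewrite form_x; crd. Qed.
Lemma mul_y1y4 : mul (Y 1) (Y 4) = - X 3.
Proof. by apply: form_inj => w; rewrite !bilE form_x; crd. Qed.
Lemma mul_y1y5 : mul (Y 1) (Y 5) = - X 2.
Proof. by apply: form_inj => w; rewrite !bilE form_x; crd. Qed.
Lemma mul_y2y3 : mul (Y 2) (Y 3) = - Y 1.
Proof. by apply: form_inj => w; rewrite !bilE form_y; crd. Qed.
Lemma mul_y2y5 : mul (Y 2) (Y 5) = X 1.
Proof. by apply: form_inj => w; rewrite form_x; crd. Qed.

(** These span [L ^ 3 = Z(L)] and [L ^ 2]; see [lpow3_P10], [center_P10] and
    [lpow2_P10]. *)
Definition center_gens : seq (gen 5) := [:: x_ 2; x_ 3; x_ 4; x_ 5].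
Definition square_gens := [:: x_ 1, y_ 1 & center_gens].
Local Notation Zs := <<[seq b g | g <- center_gens]>>%VS.
Local Notation Ws := <<[seq b g | g <- square_gens]>>%VS.

Lemma mem_square_gens u :
  reflect [/\ c (y_ 2) u = 0, c (y_ 3) u = 0, c (y_ 4) u = 0 & c (y_ 5) u = 0] (u \in Ws).
Proof.
apply: (iffP (mem_span_basis sb _ _)) => [E|[E2 E3 E4 E5]].
  by split; apply: E; rewrite !inE !y_eq.
by apply: gen5P => //; rewrite !inE eqxx ?orbT.
Qed.

Lemma mem_center_gens u : reflect [/\ u \in Ws, c (x_ 1) u = 0 & c (y_ 1) u = 0] (u \in Zs).
Proof.
apply: (iffP (mem_span_basis sb _ _)) => [E|[/mem_square_gens[E2 E3 E4 E5] Ex Ey]].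
  split; [apply/mem_square_gens; split| |]; apply: E; by rewrite !inE ?y_eq ?x_eq.
by apply: gen5P => //; rewrite !inE eqxx ?orbT.
Qed.

(** A central vector pairs to 0 with products; each coordinate other than those
    on [x_2, ..., x_5] is the pairing with a product of two basis vectors. *)
Lemma center_P10 : center L = Zs.
Proof.
apply/vspaceP=> u; apply/mem_center/mem_center_gens;
  [move=> u0 | move=> [/mem_square_gens[E2 E3 E4 E5] Ex Ey] v].
  have t v w : tri u v w = 0 by rewrite u0 form0l.
  split; [apply/mem_square_gens; split| |].
  - by rewrite -[RHS](t (Y 5) (Y 1)); crd.
  - by rewrite -[RHS](t (Y 4) (Y 1)); crd.
  - by rewrite -[RHS](t (Y 1) (Y 3)); crd.
  - by rewrite -[RHS](t (Y 1) (Y 2)); crd.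
  - by rewrite -[RHS](t (Y 2) (Y 3)); crd.
  - by rewrite -[RHS](t (Y 2) (Y 5)); crd.
apply: form_inj => w; rewrite form0l P10_triE /wedge3 E2 E3 E4 E5 Ex Ey; ring.
Qed.

Lemma coordy_mul k u v : c (y_ k) (mul u v) = - tri u v (X k).
Proof. by rewrite -form_x formC. Qed.
Lemma coordx_mul k u v : c (x_ k) (mul u v) = tri u v (Y k).
Proof. by []. Qed.

Lemma y1_square : Y 1 \in lpow L 2.
Proof. by rewrite -[Y 1]opprK -mul_y2y3 rpredN memv_mulv ?memvf. Qed.

Lemma center_gens_mulv (U : {vspace L}) : Y 1 \in U -> (Zs <= mulv U fullv)%VS.
Proof.
move=> UY; apply/span_subvP=> _ /mapP[g gz ->]; move: gz; rewrite !inE.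
case/or4P=> /eqP->.
- by rewrite -[X 2]opprK -mul_y1y5 rpredN memv_mulv ?memvf.
- by rewrite -[X 3]opprK -mul_y1y4 rpredN memv_mulv ?memvf.
- by rewrite -mul_y1y3 memv_mulv ?memvf.
- by rewrite -mul_y1y2 memv_mulv ?memvf.
Qed.

Lemma lpow2_P10 : lpow L 2 = Ws.
Proof.
apply/eqP; rewrite eqEsubv; apply/andP; split.
  by apply/mulvP=> u v _ _; apply/mem_square_gens; rewrite !coordy_mul; split; crd.
rewrite /= span_cons span_cons !subv_add -!memvE y1_square center_gens_mulv ?memvf //.
by rewrite -mul_y2y5 memv_mulv ?memvf.
Qed.

Lemma lpow3_P10 : lpow L 3 = Zs.
Proof.
apply/eqP; rewrite eqEsubv -[lpow L 3]/(mulv (lpow L 2) fullv).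
rewrite center_gens_mulv ?y1_square // andbT lpow2_P10.
apply/mulvP=> u v /mem_square_gens[E2 E3 E4 E5] _; apply/mem_center_gens.
rewrite !coordx_mul coordy_mul.
split; [apply/mem_square_gens; rewrite !coordy_mul; split | |]; crd; rewrite ?E2 ?E3 ?E4 ?E5; ring.
Qed.

(** Pairing [phi_z u] with [y_2, ..., y_5] gives two linear systems, in
    [(u_2, u_4)] and in [(u_3, u_5)], both with determinant the Pfaffian up to
    sign. *)
Lemma P10_phi_nondeg : irreducible_quadratic alpha beta ->
  forall z, z \in Ws -> z \notin Zs -> forall u, (forall v, phi z u v = 0) -> u \in Ws.
Proof.
move=> irr z zW zZ u zu; have [E2 E3 E4 E5] := mem_square_gens z zW.
have st_neq0 : ~ (c (x_ 1) z = 0 /\ c (y_ 1) z = 0).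
  by case=> s0 t0; case/mem_center_gens: zZ.
set s := c (x_ 1) z in st_neq0; set t := c (y_ 1) z in st_neq0.
have pf q : (beta * s ^+ 2 + alpha * s * t + t ^+ 2) * q = 0 -> q = 0.
  move/eqP; rewrite mulf_eq0 => /orP[/eqP/(pfaffian_neq0 irr)//|/eqP//].
have st0 q : s * q = 0 -> t * q = 0 -> q = 0.
  move=> sq tq; have [//|/mulIf q0] := eqVneq q 0.
  by case: st_neq0; split; apply: q0; rewrite mul0r.
have zY2 : s * c (y_ 3) u + t * c (y_ 5) u = 0.
  rewrite -[RHS]oppr0 -(zu (Y 2)) /phi; crd; rewrite ?E2 ?E3 ?E4 ?E5; ring.
have zY3 : s * c (y_ 2) u - (alpha * s + t) * c (y_ 4) u = 0.
  rewrite -(zu (Y 3)) /phi; crd; rewrite ?E2 ?E3 ?E4 ?E5; ring.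
have zY4 : (alpha * s + t) * c (y_ 3) u - beta * s * c (y_ 5) u = 0.
  rewrite -(zu (Y 4)) /phi; crd; rewrite ?E2 ?E3 ?E4 ?E5; ring.
have zY5 : beta * s * c (y_ 4) u + t * c (y_ 2) u = 0.
  rewrite -(zu (Y 5)) /phi; crd; rewrite ?E2 ?E3 ?E4 ?E5; ring.
have u4 : c (y_ 4) u = 0.
  apply: pf; transitivity (s * (beta * s * c (y_ 4) u + t * c (y_ 2) u)
                - t * (s * c (y_ 2) u - (alpha * s + t) * c (y_ 4) u)).
    ring.
  by rewrite zY5 zY3; ring.
have u5 : c (y_ 5) u = 0.
  apply: pf; transitivity ((alpha * s + t) * (s * c (y_ 3) u + t * c (y_ 5) u)
                - s * ((alpha * s + t) * c (y_ 3) u - beta * s * c (y_ 5) u)).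
    ring.
  by rewrite zY2 zY4; ring.
rewrite u4 !mulr0 ?subr0 ?add0r in zY3 zY5; rewrite u5 !mulr0 ?subr0 ?addr0 in zY2 zY4.
apply/mem_square_gens; split=> //; apply: st0 => //.
by move: zY4; rewrite mulrDl -mulrA zY2 mulr0 add0r.
Qed.

Lemma P10_type_C : irreducible_quadratic alpha beta -> type_C L.
Proof.
move=> irr; split; last first.
  rewrite lpow2_P10 center_P10; exact: P10_phi_nondeg.
have [/size_basis dimL _ _ _] := sb.
split.
- exists 3; apply/eqP; rewrite -subv0 -[lpow L 4]/(mulv (lpow L 3) fullv) lpow3_P10 -center_P10.
  by apply/mulvP=> u v /mem_center-> _; rewrite mem0v.
- by rewrite dimL card_sum !card_ord.
- rewrite center_P10 => u v /mem_center_gens[/mem_square_gens[E2 E3 E4 E5] Ex Ey].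
  move=> /mem_center_gens[/mem_square_gens[D2 D3 D4 D5] Dx Dy].
  rewrite (form_coordg _ _ sb) big1 // => i _.
  have cy (z : L) : c (y_ 1) z = 0 -> c (y_ 2) z = 0 -> c (y_ 3) z = 0 -> c (y_ 4) z = 0 ->
     c (y_ 5) z = 0 -> c (inr i) z = 0.
    move=> z1 z2 z3 z4 z5; pose Q g := if g is inr _ then c g z = 0 else True.
    exact: (@gen5P Q _ _ _ _ _ _ _ _ _ _ (inr i)).
  by rewrite !cy // !mul0r mulr0 subrr.
- by rewrite center_P10 dim_span_basis // /center_gens /= !inE !x_eq.
- by rewrite center_P10 lpow3_P10.
Qed.

(** Modulo [L ^ 2], the vector [v] is the image of [u] under the operator [A]
    with [phi_y (A u, w) = phi_x (u, w)], and the second equation says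
    [A ^ 2 = alpha A - beta].  The witness is the matrix of [A] on
    [y_2, ..., y_5]. *)
Lemma P10_pencil u : exists v, mul (Y 1) v = mul (X 1) u
  /\ mul (X 1) v = alpha *: mul (X 1) u - beta *: mul (Y 1) u.
Proof.
exists (- (c (y_ 2) u *: Y 4) + c (y_ 3) u *: (alpha *: Y 3 + Y 5)
  + c (y_ 4) u *: (alpha *: Y 4 + beta *: Y 2) - (beta * c (y_ 5) u) *: Y 3).
split; apply: form_inj => w.
  by rewrite !P10_triE /wedge3 !coordE ?coord_xx ?coord_yy //=; ring.
by rewrite formDl formNl !formZl !P10_triE /wedge3 !coordE ?coord_xx ?coord_yy //=; ring.
Qed.
End FromPresentation.

(** * Structure of algebras of type C *)

Section TypeC.
Variables (F : fieldType) (L : saa F).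
Implicit Types (u v w z : L).

Hypothesis tC : type_C L.
Local Notation Z := (center L).
Local Notation L2 := (lpow L 2).

Lemma center_mul0 z v : z \in Z -> mul z v = 0.
Proof. by move/mem_center. Qed.

Lemma square_perp_center u z : u \in L2 -> z \in Z -> form u z = 0.
Proof.
move=> uL zZ; suff /subvP/(_ u uL) : (L2 <= lker (linfun (form z : L -> F^o)))%VS.
  by rewrite memv_ker lfunE /= formC => /eqP->; rewrite oppr0.
apply/mulvP=> v w _ _; rewrite memv_ker lfunE /=.
by rewrite formC form_mul triR form_mul triR form_mul -triR center_mul0 // form0l oppr0.
Qed.

(** [(uv, z) = (zu, v)] up to sign, so [z] annihilates [L] exactly when it is
    orthogonal to all products. *)
Lemma center_square_perp z : z \in Z <-> forall u, u \in L2 -> form u z = 0.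
Proof.
split=> [zZ u uL | z0]; first exact: square_perp_center.
apply/mem_center => v; apply: form_inj => w; rewrite form0l form_mul z0 //.
by rewrite memv_mulv ?memvf.
Qed.

Lemma mul_square_center u v : u \in L2 -> mul u v \in Z.
Proof. by move=> uL; have [[_ _ _ _ <-] _] := tC; rewrite memv_mulv ?memvf. Qed.

Lemma center_sub_square : (Z <= L2)%VS.
Proof. by have [[_ _ _ _ <-] _] := tC; apply/mulvP=> u v _ _; rewrite memv_mulv ?memvf. Qed.

(** [(uv, w) = +/- (uw, v)] with [uw] in the center. *)
Lemma square_abelian u v : u \in L2 -> v \in L2 -> mul u v = 0.
Proof.
move=> uL vL; apply: form_inj => w; rewrite form0l -2!triR triC formC opprK.
by rewrite square_perp_center ?mul_square_center.
Qed.

Lemma dim_square : \dim L2 = 6.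
Proof.
have := dim_orthogonal center_square_perp; have [[_ -> _ -> _] _] := tC.
by lia.
Qed.

Lemma mul_square_inj z w : z \in L2 -> z \notin Z -> mul z w = 0 -> w \in L2.
Proof.
by move=> zL zZ zw; have [_ /(_ z zL zZ w)] := tC; apply=> v; rewrite /phi zw form0l.
Qed.

(** The kernel of [mul z] is [L2] and its image lies in the center, so the
    dimensions 10, 6 and 4 leave no room. *)
Lemma mul_square_onto z q : z \in L2 -> z \notin Z -> q \in Z -> exists w, mul z w = q.
Proof.
move=> zL zZ; pose f := linfun (mul z).
have kf : lker f = L2.
  apply/vspaceP=> w; rewrite memv_ker lfunE; apply/eqP/idP; first exact: mul_square_inj.
  exact: square_abelian.
have : limg f = Z.
  apply/eqP; rewrite eqEdim; apply/andP; split.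
    by apply/subvP=> _ /memv_imgP[w _ ->]; rewrite lfunE mul_square_center.
  have := limg_ker_dim f fullv; rewrite capfv kf dim_square; have [[_ -> _ -> _] _] := tC.
  by lia.
by move=> <- /memv_imgP[w _ ->]; exists w; rewrite lfunE.
Qed.

Lemma symplectic_pair : exists x y, [/\ x \in L2, y \in L2 & form x y = 1].
Proof.
have /subvPn[x xL xZ] : ~~ (L2 <= Z)%VS.
  by apply/negP=> /dimvS; rewrite dim_square; have [[_ _ _ -> _] _] := tC.
have /subvPn[y yL] : ~~ (L2 <= lker (linfun (form x : L -> F^o)))%VS.
  apply/negP=> /subvP L2x; case/negP: xZ; apply/center_square_perp => u /L2x.
  by rewrite memv_ker lfunE /= formC => /eqP->; rewrite oppr0.
rewrite memv_ker lfunE /= => xy; exists x, ((form x y)^-1 *: y).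
by rewrite xL memvZ // formZr mulVf.
Qed.
End TypeC.

(** * Normal form of the pencil *)

(** The values of [phi_x] and [phi_y] on [y_2, ..., y_5] that the presentation
    lists. *)
Record pencil_frame (F : fieldType) (L : saa F) (alpha beta : F)
    (x y y2 y3 y4 y5 : L) : Prop := PencilFrame {
  frame_x23 : tri x y2 y3 = 1;
  frame_x24 : tri x y2 y4 = 0;
  frame_x25 : tri x y2 y5 = 0;
  frame_x34 : tri x y3 y4 = alpha;
  frame_x35 : tri x y3 y5 = 0;
  frame_x45 : tri x y4 y5 = beta;
  frame_y23 : tri y y2 y3 = 0;
  frame_y24 : tri y y2 y4 = 0;
  frame_y25 : tri y y2 y5 = 1;
  frame_y34 : tri y y3 y4 = 1;
  frame_y35 : tri y y3 y5 = 0;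
  frame_y45 : tri y y4 y5 = 0
}.

Lemma sum_ord5 (V : zmodType) (f : 'I_5 -> V) : \sum_i f i =
  f (inord 0) + (f (inord 1) + (f (inord 2) + (f (inord 3) + f (inord 4)))).
Proof.
rewrite !big_ord_recl big_ord0 addr0.
by do ?congr (_ + _); congr f; apply/val_inj; rewrite /= inordK.
Qed.

Section Frames.
Variables (F : fieldType) (L : saa F).
Implicit Types (u v w z : L).
Hypothesis tC : type_C L.
Local Notation Z := (center L).
Local Notation L2 := (lpow L 2).

Lemma tri_xx u v : tri u v v = 0.
Proof. by rewrite -triR mul_alt form0l. Qed.

Lemma tri_xyx u v : tri u v u = 0.
Proof. by rewrite triCr mul_alt form0l oppr0. Qed.

Section Pair.
Variables x y : L.
Hypotheses (xL : x \in L2) (yL : y \in L2) (xy : form x y = 1).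

Lemma pair_free s t : s *: x + t *: y \in Z -> s = 0 /\ t = 0.
Proof.
move=> /[dup] /(square_perp_center xL) E /(square_perp_center yL).
move: E; rewrite !bilE !form_alt (formC x y) xy => E1 E2; split; last by rewrite -E1; ring.
by apply: oppr_inj; rewrite oppr0 -E2; ring.
Qed.

(** Any [y2] outside [L2] will do.  As [y L = Z], there is [y4] with
    [y y4 = - x y2], and then [phi_x (y2, w) = - phi_y (y4, w)] gives all the
    values involving [y2].  The vectors [y y2] and [y y4] are independent, since
    a relation would put [y2] in the radical of a member of the pencil; so
    [y3, y5] can be prescribed against them. *)
Lemma pencil_frame_exists :
  exists alpha beta y2 y3 y4 y5, pencil_frame alpha beta x y y2 y3 y4 y5.
Proof.
have ynZ : y \notin Z.
  apply/negP=> yZ; have := @pair_free 0 1; rewrite scale0r scale1r add0r => /(_ yZ)[_ /eqP].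
  by rewrite oner_eq0.
have /subvPn[y2 _ y2L] : ~~ (fullv <= L2)%VS.
  by apply/negP=> /dimvS; rewrite (dim_square tC); have [[_ -> _ _ _] _] := tC.
have [y4 y4E] := mul_square_onto tC yL ynZ (mul_square_center tC (- y2) xL).
rewrite lmulNr in y4E.
have fr : free [tuple mul y y2; mul y y4].
  apply/freeP => k; rewrite !big_ord_recl big_ord0 addr0 /= => k0.
  set p := k _ in k0; set q := k _ in k0.
  have E : mul y (p *: y2 + q *: y4) = 0 by rewrite !bilE -[RHS]k0.
  have E' := mul_square_inj tC yL ynZ E.
  have q0 : q = 0.
    apply/eqP/negPn/negP => q0; case/negP: y2L.
    have rL : q *: x - p *: y \in L2 by rewrite rpredB ?memvZ.
    apply: (mul_square_inj tC rL) => [|].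
      apply: contra q0 => rZ; have := @pair_free q (- p).
      by rewrite scaleNr => /(_ rZ)[-> _].
    have : mul y (p *: y2 + q *: y4) = 0 by [].
    rewrite !bilE y4E scalerN => /eqP; rewrite subr_eq0 => /eqP ->; exact: subrr.
  have p0 : p = 0.
    apply/eqP/negPn/negP => p0; case/negP: y2L; move: E'.
    rewrite q0 scale0r addr0 => /(memvZ p^-1); by rewrite scalerA mulVf // scale1r.
  by move=> i; case: (unliftP ord0 i) => [j ->|->] //; rewrite ord1.
have [y3 [y5 [y23 y34 y25 y45]]] : exists y3 y5,
    [/\ tri y y2 y3 = 0, tri y y4 y3 = -1, tri y y2 y5 = 1 & tri y y4 y5 = 0].
  have [D DE] := dual_family fr; exists (D (inord 1)), (- D ord0).
  have d2 i : tri y y2 (D i) = - (i == ord0)%:R by rewrite formC -(DE i ord0).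
  have d4 i : tri y y4 (D i) = - (i == inord 1)%:R.
    by rewrite formC -(DE i (inord 1)) /= inordK.
  by rewrite !formNr !d2 !d4 !eqxx opprK -!val_eqE /= inordK // !oppr0.
have x2 w : tri x y2 w = - tri y y4 w by rewrite y4E formNl opprK.
have y24 : tri y y2 y4 = 0 by rewrite triCr -[LHS]x2 tri_xx.
have y43 : tri y y3 y4 = 1 by rewrite triCr y34 opprK.
(* Adding a multiple of [y4] to [y5] kills [phi_y (y3, y5)]; adding then a
   multiple of [y2] kills [phi_x (y3, y5)] and changes no other value. *)
pose y5' := y5 - tri y y3 y5 *: y4.
have y35 : tri y y3 y5' = 0 by rewrite !bilE y43; ring.
have y25' : tri y y2 y5' = 1 by rewrite !bilE y24 y25; ring.
have y45' : tri y y4 y5' = 0 by rewrite !bilE y45 tri_xx; ring.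
clearbody y5'.
exists (tri x y3 y4), (tri x y4 (y5' + tri x y3 y5' *: y2)), y2, y3, y4.
exists (y5' + tri x y3 y5' *: y2).
split=> //.
- by rewrite x2 y34 opprK.
- by rewrite x2 tri_xx oppr0.
- by rewrite x2 !bilE y45' (triCr y y2) y24; ring.
- by rewrite !bilE (triCr x y2) x2 y34; ring.
- by rewrite !bilE y25' tri_xx; ring.
- by rewrite !bilE y35 (triCr y y2) y23; ring.
- by rewrite !bilE y45' (triCr y y2) y24; ring.
Qed.

Lemma tri_shift z u v w w' : z \in L2 -> w \in L2 -> w' \in L2 ->
  tri z (u + w) (v + w') = tri z u v.
Proof.
move=> zL wL w'L; rewrite !bilE (square_abelian tC zL wL) (triCr z w') (square_abelian tC zL w'L).
by rewrite !bilE; ring.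
Qed.

Lemma frame_shift alpha beta y2 y3 y4 y5 w2 w3 w4 w5 :
  w2 \in L2 -> w3 \in L2 -> w4 \in L2 -> w5 \in L2 ->
  pencil_frame alpha beta x y y2 y3 y4 y5 ->
  pencil_frame alpha beta x y (y2 + w2) (y3 + w3) (y4 + w4) (y5 + w5).
Proof. by move=> w2L w3L w4L w5L []; split; rewrite tri_shift. Qed.

Lemma tri_add_line z u v w p q r :
  tri (u + p *: z) (v + q *: z) (w + r *: z)
  = tri u v w + p * tri z v w - q * tri z u w + r * tri z u v.
Proof.
rewrite !bilE !mul_alt !form0l (lmulC z u) ?bilE !(tri_xx, tri_xyx).
have -> : tri u v z = tri z u v by exact: triR.
ring.
Qed.

(** Adding [p y] to one vector changes the trilinear form on three of them by
    [p phi_y] of the other two; as [phi_y] is non-zero only on [(y2, y5)] and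
    [(y3, y4)], each of the four triples has one vector that corrects it
    independently of the others. *)
Lemma frame_kill alpha beta y2 y3 y4 y5 :
  pencil_frame alpha beta x y y2 y3 y4 y5 ->
  exists y2 y3 y4 y5, [/\ pencil_frame alpha beta x y y2 y3 y4 y5,
    tri y2 y3 y4 = 0, tri y2 y3 y5 = 0, tri y2 y4 y5 = 0 & tri y3 y4 y5 = 0].
Proof.
move=> fr.
exists (y2 + (- tri y2 y3 y4) *: y), (y3 + tri y2 y3 y5 *: y),
  (y4 + tri y2 y4 y5 *: y), (y5 + (- tri y3 y4 y5) *: y).
case: (fr) => _ _ _ _ _ _ y23 y24 y25 y34 y35 y45.
split; first by apply: frame_shift; rewrite ?memvZ.
- by rewrite tri_add_line y23 y24 y34; ring.
- by rewrite tri_add_line y23 y25 y35; ring.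
- by rewrite tri_add_line y24 y25 y45; ring.
- by rewrite tri_add_line y34 y35 y45; ring.
Qed.
End Pair.

(** * From a frame to a presentation *)

Section FrameDual.
Variables (alpha beta : F) (x y y2 y3 y4 y5 : L).
Hypotheses (xL : x \in L2) (yL : y \in L2) (xy : form x y = 1).
Hypothesis fr : pencil_frame alpha beta x y y2 y3 y4 y5.

(* The values of [phi_y] make these dual to [y2, ..., y5] ([dual_form]). *)
Let x2 := - mul y y5.
Let x3 := - mul y y4.
Let x4 := mul y y3.
Let x5 := mul y y2.

Lemma dual_center : [/\ x2 \in Z, x3 \in Z, x4 \in Z & x5 \in Z].
Proof. by split; rewrite ?rpredN (mul_square_center tC). Qed.

Lemma dual_form :
  [/\ [/\ form x2 y2 = 1, form x2 y3 = 0, form x2 y4 = 0 & form x2 y5 = 0],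
      [/\ form x3 y2 = 0, form x3 y3 = 1, form x3 y4 = 0 & form x3 y5 = 0],
      [/\ form x4 y2 = 0, form x4 y3 = 0, form x4 y4 = 1 & form x4 y5 = 0]
    & [/\ form x5 y2 = 0, form x5 y3 = 0, form x5 y4 = 0 & form x5 y5 = 1]].
Proof.
case: fr => _ _ _ _ _ _ y23 y24 y25 y34 y35 y45.
have s u v : tri y u v = - tri y v u by exact: triCr.
split; rewrite /x2 /x3 /x4 /x5 ?formNl tri_xx.
- by rewrite (s y5) y25 (s y5 y3) y35 (s y5 y4) y45 !opprK !oppr0.
- by rewrite (s y4) y24 (s y4 y3) y34 y45 !opprK !oppr0.
- by rewrite (s y3) y23 y34 y35 !oppr0.
- by rewrite y23 y24 y25.
Qed.

Lemma tri_center u v w z z' z'' : z \in Z -> z' \in Z -> z'' \in Z ->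
  tri (u + z) (v + z') (w + z'') = tri u v w.
Proof.
move=> zZ zZ' zZ''; have t u' v' : tri u' v' z'' = 0 by rewrite -2!triR center_mul0 ?form0l.
rewrite formDr t addr0 lmulDl (center_mul0 _ zZ) lmulDr.
by rewrite (lmulC z') (center_mul0 _ zZ') !(oppr0, addr0).
Qed.

Lemma form_center u v z z' : u \in L2 -> z \in Z -> z' \in Z ->
  form (u + z) (v + z') = form u v + form z v.
Proof.
move=> uL zZ zZ'; rewrite !bilE (square_perp_center uL zZ') (square_perp_center _ zZ') ?addr0 //.
exact: (subvP (center_sub_square tC)).
Qed.

(** Central vectors do not affect products, and pair with [y2, ..., y5] in a
    prescribed way: Gram-Schmidt modulo the center, which leaves [y2] alone. *)
Lemma frame_orthogonalize : exists zx zy z3 z4 z5,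
  [/\ [/\ zx \in Z, zy \in Z, z3 \in Z, z4 \in Z & z5 \in Z],
      [/\ form (x + zx) y2 = 0, form (x + zx) (y3 + z3) = 0,
           form (x + zx) (y4 + z4) = 0 & form (x + zx) (y5 + z5) = 0],
      [/\ form (y + zy) y2 = 0, form (y + zy) (y3 + z3) = 0,
           form (y + zy) (y4 + z4) = 0 & form (y + zy) (y5 + z5) = 0],
      [/\ form (y3 + z3) y2 = 0, form (y4 + z4) y2 = 0 & form (y5 + z5) y2 = 0]
    & [/\ form (y4 + z4) (y3 + z3) = 0, form (y5 + z5) (y3 + z3) = 0
         & form (y5 + z5) (y4 + z4) = 0]].
Proof.
move: dual_center dual_form; move: (x2) (x3) (x4) (x5) => e2 e3 e4 e5 [e2Z e3Z e4Z e5Z].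
move=> [[d22 d23 d24 d25] [d32 d33 d34 d35] [d42 d43 d44 d45] [d52 d53 d54 d55]].
pose z p q r s := p *: e2 + q *: e3 + r *: e4 + s *: e5.
have zZ p q r s : z p q r s \in Z by rewrite /z !rpredD ?memvZ.
have f2 p q r s : form (z p q r s) y2 = p by rewrite /z !bilE d22 d32 d42 d52; ring.
have f3 p q r s : form (z p q r s) y3 = q by rewrite /z !bilE d23 d33 d43 d53; ring.
have f4 p q r s : form (z p q r s) y4 = r by rewrite /z !bilE d24 d34 d44 d54; ring.
have f5 p q r s : form (z p q r s) y5 = s by rewrite /z !bilE d25 d35 d45 d55; ring.
have zz p q r s p' q' r' s' : form (z p q r s) (z p' q' r' s') = 0.
  by apply: square_perp_center (zZ _ _ _ _); apply: (subvP (center_sub_square tC)).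
have g p q r s w : form w (z p q r s) = - form (z p q r s) w by exact: formC.
clearbody z.
exists (z (- form x y2) (- form x y3) (- form x y4) (- form x y5)).
exists (z (- form y y2) (- form y y3) (- form y y4) (- form y y5)).
exists (z (- form y3 y2) 0 0 0), (z (- form y4 y2) (- form y4 y3) 0 0).
exists (z (- form y5 y2) (- form y5 y3) (- form y5 y4) 0).
split.
- by split.
- by split; rewrite ?form_center // ?formDl ?f2 ?f3 ?f4 ?f5 subrr.
- by split; rewrite ?form_center // ?formDl ?f2 ?f3 ?f4 ?f5 subrr.
- by split; rewrite formDl f2 subrr.
- by split; rewrite formDr !formDl zz g ?f2 ?f3 ?f4 ?f5; ring.
Qed.
End FrameDual.

Section OrthogonalFrame.
Variables (alpha beta : F) (x y y2 y3 y4 y5 : L).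
Hypotheses (xL : x \in L2) (yL : y \in L2) (xy : form x y = 1).
Hypothesis fr : pencil_frame alpha beta x y y2 y3 y4 y5.
Hypotheses (t234 : tri y2 y3 y4 = 0) (t235 : tri y2 y3 y5 = 0)
  (t245 : tri y2 y4 y5 = 0) (t345 : tri y3 y4 y5 = 0).
Hypothesis orth_x : [/\ form x y2 = 0, form x y3 = 0, form x y4 = 0 & form x y5 = 0].
Hypothesis orth_y : [/\ form y y2 = 0, form y y3 = 0, form y y4 = 0 & form y y5 = 0].
Hypothesis orth_y2 : [/\ form y3 y2 = 0, form y4 y2 = 0 & form y5 y2 = 0].
Hypothesis orth_yy : [/\ form y4 y3 = 0, form y5 y3 = 0 & form y5 y4 = 0].

Definition frame_basis (g : gen 5) : L :=
  match g with
  | inl i => nth 0 [:: x; - mul y y5; - mul y y4; mul y y3; mul y y2] i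
  | inr i => nth 0 [:: y; y2; y3; y4; y5] i
  end.
Local Notation b := frame_basis.
Arguments frame_basis : simpl never.

Lemma frame_basis_center (i : 'I_5) : i != ord0 -> b (inl i) \in Z.
Proof.
have [x2Z x3Z x4Z x5Z] := dual_center y2 y3 y4 y5 yL.
by case: i => -[|[|[|[|[|//]]]]].
Qed.

Lemma frame_gram : gram b.
Proof.
have [x2Z x3Z x4Z x5Z] := dual_center y2 y3 y4 y5 yL.
have [[d22 d23 d24 d25] [d32 d33 d34 d35] [d42 d43 d44 d45] [d52 d53 d54 d55]] := dual_form fr.
have xL2 i : b (inl i) \in L2.
  have [->//|/frame_basis_center] := eqVneq i ord0.
  exact: (subvP (center_sub_square tC)).
split.
- move=> i j; have [->|/frame_basis_center jZ] := eqVneq j ord0; last exact: square_perp_center jZ.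
  have [->|/frame_basis_center iZ] := eqVneq i ord0; first exact: form_alt.
  by rewrite formC (square_perp_center _ iZ) ?oppr0.
- case: orth_y => o2 o3 o4 o5; case: orth_y2 => o32 o42 o52; case: orth_yy => o43 o53 o54.
  move=> [[|[|[|[|[|//]]]]] ?] [[|[|[|[|[|//]]]]] ?]; rewrite /b /=; rewrite ?form_alt //;
    by rewrite formC ?o2 ?o3 ?o4 ?o5 ?o32 ?o42 ?o52 ?o43 ?o53 ?o54 oppr0.
case: orth_x => o2 o3 o4 o5.
have zy z : z \in Z -> form z y = 0.
  by move=> zZ; rewrite formC square_perp_center ?oppr0.
by move=> [[|[|[|[|[|//]]]]] ?] [[|[|[|[|[|//]]]]] ?]; rewrite /b //= zy.
Qed.

Lemma frame_standard : standard_basis b.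
Proof. by apply: gram_dim_basis frame_gram _; have [[_ -> _ _ _] _] := tC. Qed.

Lemma frame_basisE : ((b (x_ 1) = x) * (b (y_ 1) = y) * (b (y_ 2) = y2)
  * (b (y_ 3) = y3) * (b (y_ 4) = y4) * (b (y_ 5) = y5))%type.
Proof. by do !split; rewrite /b /= inordK. Qed.

Local Notation c := (coordg b).

(* Up to its central component, which products ignore, [u] is the sum of the
   next two vectors ([frame_decomposition]). *)
Definition square_part u : L := c (x_ 1) u *: x + c (y_ 1) u *: y.
Definition y_part u : L :=
  c (y_ 2) u *: y2 + c (y_ 3) u *: y3 + c (y_ 4) u *: y4 + c (y_ 5) u *: y5.

Lemma frame_decomposition u : exists2 z, z \in Z & u = square_part u + y_part u + z.
Proof.
have [x2Z x3Z x4Z x5Z] := dual_center y2 y3 y4 y5 yL.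
exists (\sum_(i < 5 | i != inord 0) c (inl i) u *: b (inl i)).
  apply: rpred_sum => i ni; apply/memvZ/frame_basis_center.
  by apply: contraNneq ni => ->; rewrite -val_eqE /= inordK.
rewrite {1}(coordg_sum u frame_standard) big_sumType (bigD1 (inord 0)) //= sum_ord5.
rewrite -/(x_ 1) -/(y_ 1) -/(y_ 2) -/(y_ 3) -/(y_ 4) -/(y_ 5) !frame_basisE.
by rewrite addrAC /square_part /y_part !addrA.
Qed.

Lemma y_part_tri u v w : tri (y_part u) (y_part v) (y_part w) = 0.
Proof.
have y_tri p q : [/\ p \in [:: y2; y3; y4; y5] & q \in [:: y2; y3; y4; y5]] ->
    tri p q (y_part w) = 0.
  suff sym : [/\ tri y2 y3 (y_part w) = 0, tri y2 y4 (y_part w) = 0 &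
            tri y2 y5 (y_part w) = 0] /\ 
      [/\ tri y3 y4 (y_part w) = 0, tri y3 y5 (y_part w) = 0 & tri y4 y5 (y_part w) = 0].
    case: sym => -[t23 t24 t25] [t34 t35 t45]; rewrite !inE.
    case=> /or4P[] /eqP-> /or4P[] /eqP->; rewrite ?mul_alt ?form0l //;
      by rewrite lmulC formNl ?t23 ?t24 ?t25 ?t34 ?t35 ?t45 oppr0.
  have t r p' q' : tri p' q' r = tri r p' q' by rewrite triR.
  have t243 : tri y2 y4 y3 = 0 by rewrite triCr t234 oppr0.
  have t253 : tri y2 y5 y3 = 0 by rewrite triCr t235 oppr0.
  have t254 : tri y2 y5 y4 = 0 by rewrite triCr t245 oppr0.
  have t354 : tri y3 y5 y4 = 0 by rewrite triCr t345 oppr0.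
  have t342 : tri y3 y4 y2 = 0 by rewrite triR t234.
  have t352 : tri y3 y5 y2 = 0 by rewrite triR t235.
  have t452 : tri y4 y5 y2 = 0 by rewrite triR t245.
  have t453 : tri y4 y5 y3 = 0 by rewrite triR t345.
  rewrite /y_part; split; split; rewrite !formDr !formZr !(tri_xx, tri_xyx).
  - rewrite t234 t235; ring.
  - rewrite t243 t245; ring.
  - rewrite t253 t254; ring.
  - rewrite t342 t345; ring.
  - rewrite t352 t354; ring.
  - rewrite t452 t453; ring.
rewrite {1}/y_part {1}/y_part !(lmulDl, lmulDr, lmulZl, lmulZr) !(formDl, formZl).
by rewrite !y_tri ?inE ?eqxx ?orbT //; ring.
Qed.

Lemma phi_x_y_part u v : tri x (y_part u) (y_part v) =
  (c (y_ 2) u * c (y_ 3) v - c (y_ 2) v * c (y_ 3) u)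
  + alpha * (c (y_ 3) u * c (y_ 4) v - c (y_ 3) v * c (y_ 4) u)
  + beta * (c (y_ 4) u * c (y_ 5) v - c (y_ 4) v * c (y_ 5) u).
Proof.
have s p q : tri x p q = - tri x q p by exact: triCr.
have [e23 e24 e25 e34 e35 e45 _ _ _ _ _ _] := fr.
rewrite /y_part !(lmulDr, lmulZr) !(formDl, formZl) !formDr !formZr !tri_xx.
rewrite e23 e24 e25 e34 e35 e45 (s y3 y2) (s y4 y2) (s y5 y2) (s y4 y3) (s y5 y3) (s y5 y4).
rewrite e23 e24 e25 e34 e35 e45; ring.
Qed.

Lemma phi_y_y_part u v : tri y (y_part u) (y_part v) =
  (c (y_ 2) u * c (y_ 5) v - c (y_ 2) v * c (y_ 5) u)
  + (c (y_ 3) u * c (y_ 4) v - c (y_ 3) v * c (y_ 4) u).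
Proof.
have s p q : tri y p q = - tri y q p by exact: triCr.
have [_ _ _ _ _ _ e23 e24 e25 e34 e35 e45] := fr.
rewrite /y_part !(lmulDr, lmulZr) !(formDl, formZl) !formDr !formZr !tri_xx.
rewrite e23 e24 e25 e34 e35 e45 (s y3 y2) (s y4 y2) (s y5 y2) (s y4 y3) (s y5 y3) (s y5 y4).
rewrite e23 e24 e25 e34 e35 e45; ring.
Qed.

(** Terms with two arguments in an abelian subspace vanish. *)
Lemma tri_split s1 s2 s3 v1 v2 v3 :
    mul s1 s2 = 0 -> mul s1 s3 = 0 -> mul s2 s3 = 0 -> tri v1 v2 v3 = 0 ->
  tri (s1 + v1) (s2 + v2) (s3 + v3) = tri s1 v2 v3 + tri s2 v3 v1 + tri s3 v1 v2.
Proof.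
move=> s12 s13 s23 v0; rewrite !(lmulDl, lmulDr) !formDl !formDr s12 !form0l v0.
have -> : tri s1 v2 s3 = 0 by rewrite triCr s13 form0l oppr0.
have -> : tri v1 s2 s3 = 0 by rewrite -triR s23 form0l.
have -> : tri v1 s2 v3 = tri s2 v3 v1 by exact/esym/triR.
have -> : tri v1 v2 s3 = tri s3 v1 v2 by exact: triR.
ring.
Qed.

Lemma frame_presents : presents b (P10_44 alpha beta).
Proof.
apply/presentsP; first exact: P10_consistent.
split=> [|u v w]; first exact: frame_standard.
have [z zZ uE] := frame_decomposition u; have [z' zZ' vE] := frame_decomposition v.
have [z'' zZ'' wE] := frame_decomposition w.
rewrite {1}uE {1}vE {1}wE tri_center //.
rewrite tri_split ?y_part_tri //; try by rewrite (square_abelian tC) // rpredD ?memvZ.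
rewrite /ptri !big_cons big_nil /= /wedge3.
rewrite {1 2 3}/square_part !(lmulDl, lmulZl) !(formDl, formZl) !phi_x_y_part !phi_y_y_part.
ring.
Qed.
End OrthogonalFrame.
End Frames.

(** * Change of symplectic pair *)

Section Classification.
Variables (F : fieldType) (L : saa F).
Implicit Types (u v w z : L).
Local Notation Z := (center L).
Local Notation L2 := (lpow L 2).

(** Every symplectic pair of [L2 / Z] is, modulo the center, the pair [x_1, y_1]
    of a presentation. *)
Lemma pair_presentation x y :
  type_C L -> x \in L2 -> y \in L2 -> form x y = 1 ->
  exists alpha beta (b : gen 5 -> L), [/\ presents b (P10_44 alpha beta),
    b (x_ 1) - x \in Z & b (y_ 1) - y \in Z].
Proof.
move=> tC xL yL xy.
have [alpha [beta [p2 [p3 [p4 [p5 fr0]]]]]] := pencil_frame_exists tC xL yL xy.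
have [y2 [y3 [y4 [y5 [fr t234 t235 t245 t345]]]]] := frame_kill tC xL yL fr0.
have [zx [zy [z3 [z4 [z5 [[zxZ zyZ z3Z z4Z z5Z] ox oy oy2 oyy]]]]]] :=
  frame_orthogonalize tC xL yL fr.
have ZL := subvP (center_sub_square tC).
have xL' : x + zx \in L2 by rewrite rpredD // ZL.
have yL' : y + zy \in L2 by rewrite rpredD // ZL.
have xy' : form (x + zx) (y + zy) = 1.
  by rewrite (form_center tC) // xy formC (square_perp_center yL) ?oppr0 ?addr0.
have t u v w z z' z'' : z \in Z -> z' \in Z -> z'' \in Z ->
  tri (u + z) (v + z') (w + z'') = tri u v w by exact: tri_center.
have fr' : pencil_frame alpha beta (x + zx) (y + zy) y2 (y3 + z3) (y4 + z4) (y5 + z5).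
  by rewrite -[y2]addr0; case: fr => *; split; rewrite t ?mem0v.
have T234 : tri y2 (y3 + z3) (y4 + z4) = 0 by rewrite -[y2]addr0 t ?mem0v.
have T235 : tri y2 (y3 + z3) (y5 + z5) = 0 by rewrite -[y2]addr0 t ?mem0v.
have T245 : tri y2 (y4 + z4) (y5 + z5) = 0 by rewrite -[y2]addr0 t ?mem0v.
have T345 : tri (y3 + z3) (y4 + z4) (y5 + z5) = 0 by rewrite t.
exists alpha, beta, (frame_basis (x + zx) (y + zy) y2 (y3 + z3) (y4 + z4) (y5 + z5)).
split; first exact: frame_presents.
  by rewrite frame_basisE addrC addKr.
by rewrite frame_basisE addrC addKr.
Qed.

(** If [t] is a root, then [y_5 - t y_3] is in the radical of [phi_z] for
    [z = x_1 + t y_1]. *)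
Lemma presents_irreducible alpha beta (b : gen 5 -> L) :
  type_C L -> presents b (P10_44 alpha beta) ->
  irreducible_quadratic alpha beta.
Proof.
move=> tC bP; apply/quadratic_noroot => t; apply/eqP => t0.
have sb : standard_basis b by case: bP.
have zL : b (x_ 1) + t *: b (y_ 1) \in L2.
  rewrite (lpow2_P10 bP); apply/(mem_square_gens bP).
  by split; rewrite !(coordE bP) !(coord_yy bP) //= mulr0 addr0.
have znZ : b (x_ 1) + t *: b (y_ 1) \notin Z.
  rewrite (center_P10 bP); apply/negP => /(mem_center_gens bP)[_ /eqP].
  by rewrite !(coordE bP) // (coord_xx bP) //= mulr0 addr0 oner_eq0.
have : b (y_ 5) - t *: b (y_ 3) \in L2.
  have [_ /(_ _ zL znZ)] := tC; apply=> v; rewrite /phi (P10_triE bP) /wedge3 !(coordE bP) //.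
  rewrite !(coord_xx bP, coord_yy bP) //=.
  transitivity (- (t ^+ 2 + alpha * t + beta) * coordg b (y_ 4) v); first ring.
  by rewrite t0 oppr0 mul0r.
rewrite (lpow2_P10 bP) => /(mem_square_gens bP)[_ _ _ /eqP].
by rewrite !(coordE bP) // !(coord_yy bP) //= mulr0 subr0 oner_eq0.
Qed.

Section Coordinates.
Variables (alpha beta : F) (b : gen 5 -> L).
Hypothesis bP : presents b (P10_44 alpha beta).
Let sb : standard_basis b. Proof. by case: bP. Qed.
Local Notation c := (coordg b).

Lemma x1_square : b (x_ 1) \in L2.
Proof. by rewrite (lpow2_P10 bP); apply/memv_span/map_f; rewrite !inE eqxx. Qed.

Lemma form_x1y1 : form (b (x_ 1)) (b (y_ 1)) = 1.
Proof. by have := coord_xx bP (isT : 0 < 1 <= 5)%N (isT : 0 < 1 <= 5)%N. Qed.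

Lemma y2_not_square : b (y_ 2) \notin L2.
Proof.
rewrite (lpow2_P10 bP); apply/negP => /(mem_square_gens bP)[/eqP].
by rewrite (coord_yy bP) // oner_eq0.
Qed.

Lemma square_decomposition u : u \in L2 ->
  u - (c (x_ 1) u *: b (x_ 1) + c (y_ 1) u *: b (y_ 1)) \in Z.
Proof.
rewrite (lpow2_P10 bP) (center_P10 bP) => /(mem_square_gens bP)[E2 E3 E4 E5].
apply/(mem_center_gens bP); split.
- apply/(mem_square_gens bP); rewrite !(coordE bP) // E2 E3 E4 E5 !(coord_yy bP) //=.
  by split; ring.
- by rewrite !(coordE bP) // (coord_xx bP) // //=; ring.
- by rewrite !(coordE bP) // (coord_yy bP) //=; ring.
Qed.

Lemma mul_square_coord u w : u \in L2 ->
  mul u w = c (x_ 1) u *: mul (b (x_ 1)) w + c (y_ 1) u *: mul (b (y_ 1)) w.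
Proof.
move=> /square_decomposition/(center_mul0 w)/eqP; rewrite lmulDl lmulNl subr_eq0 => /eqP->.
by rewrite lmulDl !lmulZl.
Qed.

Lemma form_square_coord u v : u \in L2 -> v \in L2 ->
  form u v = c (x_ 1) u * c (y_ 1) v - c (y_ 1) u * c (x_ 1) v.
Proof.
move=> uL vL; rewrite -{1}[u](subrK (c (x_ 1) u *: b (x_ 1) + c (y_ 1) u *: b (y_ 1))).
rewrite formDl [X in X + _]formC (square_perp_center vL) ?square_decomposition // oppr0 add0r.
rewrite formDl !formZl (form_x b) (form_y b); ring.
Qed.
End Coordinates.

(** Write [A] and [A'] for the operators of [P10_pencil] attached to the two
    pairs.  The plane spanned by [u] and [A u] is stable under
    [A' = (a A + b) / (c A + d)], so [A' u] is found in that plane by solving a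
    linear system whose determinant [N] is the norm of [c A + d]; another
    solution differs by a vector that [y'], hence [x'], annihilates.  The
    equation of [A'] at [u] then determines [alpha'] and [beta']. *)
Lemma pencil_transform (x y x' y' u : L) (alpha beta alpha' beta' a b c d : F) :
    (forall w, mul x' w = a *: mul x w + b *: mul y w) ->
    (forall w, mul y' w = c *: mul x w + d *: mul y w) ->
    a * d - b * c = 1 -> d ^+ 2 + c * d * alpha + c ^+ 2 * beta != 0 ->
    (forall s t, s *: mul x u + t *: mul y u = 0 -> s = 0 /\ t = 0) ->
    (forall w, mul y' w = 0 -> mul x' w = 0) ->
    (exists v, mul y v = mul x u /\ mul x v = alpha *: mul x u - beta *: mul y u) ->
    (exists v, mul y' v = mul x' u /\ mul x' v = alpha' *: mul x' u - beta' *: mul y' u) ->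
  alpha' = ((a * d + b * c) * alpha + 2%:R * a * c * beta + 2%:R * b * d)
           / (d ^+ 2 + c * d * alpha + c ^+ 2 * beta)
  /\ beta' = (b ^+ 2 + a * b * alpha + a ^+ 2 * beta)
             / (d ^+ 2 + c * d * alpha + c ^+ 2 * beta).
Proof.
set N := d ^+ 2 + _ + _; move=> x'E y'E det N0 indep ker [v [yv xv]] [v' [yv' xv']].
set p := mul x u in indep yv xv; set q := mul y u in indep xv.
have pq_eq s t s' t' : s *: p + t *: q = s' *: p + t' *: q -> s = s' /\ t = t'.
  move/eqP; rewrite -subr_eq0 opprD addrACA -!scalerBl => /eqP/indep[/eqP + /eqP].
  by rewrite !subr_eq0 => /eqP-> /eqP->.
(* [m u + n A u] is [A' u]. *)
pose n := (a * d - b * c) / N; pose m := (a * c * beta + b * (c * alpha + d)) / N.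
have [x'u y'u] : mul x' u = a *: p + b *: q /\ mul y' u = c *: p + d *: q by [].
have x'v : mul x' v = (a * alpha + b) *: p - (a * beta) *: q.
  by rewrite x'E yv xv scalerBr !scalerA addrAC -scalerDl.
have y'v : mul y' v = (c * alpha + d) *: p - (c * beta) *: q.
  by rewrite y'E yv xv scalerBr !scalerA addrAC -scalerDl.
have lin e f g h s t : s *: (e *: p + f *: q) + t *: (g *: p - h *: q)
    = (s * e + t * g) *: p + (s * f - t * h) *: q.
  by rewrite scalerDr scalerBr !scalerA addrACA -scalerDl -scalerBl.
have y'w : mul y' (m *: u + n *: v) = mul y' v'.
  rewrite yv' x'u lmulDr !lmulZr y'u y'v lin.
  by congr (_ *: _ + _ *: _); rewrite /m /n /N; field.
have : mul x' (m *: u + n *: v) = mul x' v'.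
  apply/eqP; rewrite -subr_eq0 -lmulNr -lmulDr; apply/eqP/ker.
  by rewrite lmulDr lmulNr y'w subrr.
rewrite xv' x'u y'u lmulDr !lmulZr x'u x'v lin !scalerDr !scalerA opprD addrACA.
rewrite -!scalerBl => /pq_eq[E1 E2]; split.
  transitivity (d * (m * a + n * (a * alpha + b)) - c * (m * b - n * (a * beta))).
    by rewrite E1 E2 -[LHS]mulr1 -[X in _ * X = _]det; ring.
  by rewrite -[RHS]mulr1 -[X in _ = _ * X]det /m /n /N; field.
transitivity (b * (m * a + n * (a * alpha + b)) - a * (m * b - n * (a * beta))).
  by rewrite E1 E2 -[LHS]mulr1 -[X in _ * X = _]det; ring.
by rewrite -[RHS]mulr1 -[X in _ = _ * X]det /m /n /N; field.
Qed.

Lemma presents_change (alpha beta alpha' beta' : F) (b b' : gen 5 -> L)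
    (c := coordg b) (s := b' (x_ 1)) (t := b' (y_ 1)) :
  irreducible_quadratic alpha beta ->
  presents b (P10_44 alpha beta) -> presents b' (P10_44 alpha' beta') ->
  [/\ c (x_ 1) s * c (y_ 1) t - c (y_ 1) s * c (x_ 1) t = 1,
      alpha' = ((c (x_ 1) s * c (y_ 1) t + c (y_ 1) s * c (x_ 1) t) * alpha
                + 2%:R * c (x_ 1) s * c (x_ 1) t * beta
                + 2%:R * c (y_ 1) s * c (y_ 1) t)
               / (c (y_ 1) t ^+ 2 + c (x_ 1) t * c (y_ 1) t * alpha + c (x_ 1) t ^+ 2 * beta)
    & beta' = (c (y_ 1) s ^+ 2 + c (x_ 1) s * c (y_ 1) s * alpha + c (x_ 1) s ^+ 2 * beta)
              / (c (y_ 1) t ^+ 2 + c (x_ 1) t * c (y_ 1) t * alpha + c (x_ 1) t ^+ 2 * beta)].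
Proof.
move=> irr bP bP'; have tC := P10_type_C bP irr.
have [sL tL] := (x1_square bP', y1_square bP').
have det : c (x_ 1) s * c (y_ 1) t - c (y_ 1) s * c (x_ 1) t = 1.
  by rewrite -(form_square_coord bP) // (form_x1y1 bP').
have tnZ : t \notin center L.
  apply/negP=> tZ; have := pair_free sL tL (form_x1y1 bP') (s := 0) (t := 1).
  by rewrite scale0r scale1r add0r => /(_ tZ)[_ /eqP]; rewrite oner_eq0.
have N0 : c (y_ 1) t ^+ 2 + c (x_ 1) t * c (y_ 1) t * alpha + c (x_ 1) t ^+ 2 * beta != 0.
  apply/eqP=> N0; have [c0 d0] : c (x_ 1) t = 0 /\ c (y_ 1) t = 0.
    by apply: (pfaffian_neq0 irr); rewrite -N0; ring.
  by move: det; rewrite c0 d0 !mulr0 subrr => /esym/eqP; rewrite oner_eq0.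
have indep p q : p *: mul (b (x_ 1)) (b (y_ 2)) + q *: mul (b (y_ 1)) (b (y_ 2)) = 0 ->
    p = 0 /\ q = 0.
  have [xL yL] := (x1_square bP, y1_square bP).
  rewrite -!lmulZl -lmulDl => E; apply: (pair_free xL yL (form_x1y1 bP)).
  apply: contraNT (y2_not_square bP) => nZ.
  by apply: (mul_square_inj tC _ nZ E); rewrite rpredD ?memvZ.
have ker w : mul t w = 0 -> mul s w = 0.
  by move=> tw; apply: (square_abelian tC sL); apply: mul_square_inj tw.
have [] := pencil_transform (fun w => mul_square_coord bP w sL)
  (fun w => mul_square_coord bP w tL) det N0 indep ker (P10_pencil bP _) (P10_pencil bP' _).
by split.
Qed.
End Classification.

(** * The classification *)

Section Isomorphism.
Variables (F : fieldType) (alpha beta alpha' beta' : F).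

(** Both directions compare presentations through their pairs [x_1, y_1]: for
    the converse, [pair_presentation] gives one with the prescribed pair, and
    [presents_change] computes its parameters. *)
Lemma presentation_change (L : saa F) :
  irreducible_quadratic alpha beta -> has_presentation L (P10_44 alpha beta) ->
  has_presentation L (P10_44 alpha' beta') <->
  exists a b c d : F,
    [/\ a * d - b * c = 1,
        alpha' = ((a * d + b * c) * alpha + 2%:R * a * c * beta + 2%:R * b * d)
                 / (d ^+ 2 + c * d * alpha + c ^+ 2 * beta)
      & beta' = (b ^+ 2 + a * b * alpha + a ^+ 2 * beta)
                / (d ^+ 2 + c * d * alpha + c ^+ 2 * beta)].
Proof.
move=> irr [b bP]; split=> [[b' bP'] | [p [q [r [s [det -> ->]]]]]].
  by do 4!eexists; apply: presents_change irr bP bP'.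
have tC := P10_type_C bP irr.
pose x := p *: b (x_ 1) + q *: b (y_ 1); pose y := r *: b (x_ 1) + s *: b (y_ 1).
have [x1L y1L] := (x1_square bP, y1_square bP).
have xL : x \in lpow L 2 by rewrite rpredD ?memvZ.
have yL : y \in lpow L 2 by rewrite rpredD ?memvZ.
have xy : form x y = 1.
  by rewrite /x /y !bilE !form_alt (formC (b (x_ 1)) (b (y_ 1))) (form_x1y1 bP) -[RHS]det; ring.
have [alpha'' [beta'' [b'' [bP'' xZ yZ]]]] := pair_presentation tC xL yL xy.
have coord_eq u v g : g \in [:: x_ 1; y_ 1] -> u - v \in center L -> coordg b g u = coordg b g v.
  rewrite (center_P10 bP) !inE => gE /(mem_center_gens bP)[_ /eqP + /eqP].
  by rewrite !(coordE bP) !subr_eq0 => /eqP ? /eqP ?; case/orP: gE => /eqP->.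
have [_] := presents_change irr bP bP''.
rewrite !(coord_eq _ _ _ _ xZ) ?(coord_eq _ _ _ _ yZ) ?inE ?eqxx ?orbT //.
rewrite /x /y !(coordE bP) !(coord_xx bP) ?(coord_yy bP) //= !(mulr0, mulr1, addr0, add0r).
by move=> <- <-; exists b''.
Qed.
End Isomorphism.

Theorem proposition6p10 (F : fieldType) :
  (forall L : saa F, type_C L ->
     exists alpha beta : F,
       irreducible_quadratic alpha beta /\ has_presentation L (P10_44 alpha beta))
  /\
  (forall alpha beta : F, irreducible_quadratic alpha beta ->
     (exists L : saa F, has_presentation L (P10_44 alpha beta)) /\
     (forall L : saa F, has_presentation L (P10_44 alpha beta) -> type_C L))
  /\
  (forall alpha beta alpha' beta' : F,
     irreducible_quadratic alpha beta -> irreducible_quadratic alpha' beta' ->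
     forall L L' : saa F,
       has_presentation L (P10_44 alpha beta) ->
       has_presentation L' (P10_44 alpha' beta') ->
       (isomorphic L L' <->
        exists a b c d : F,
          [/\ a * d - b * c = 1,
              alpha' = ((a * d + b * c) * alpha + 2%:R * a * c * beta + 2%:R * b * d)
                       / (d ^+ 2 + c * d * alpha + c ^+ 2 * beta)
            & beta' = (b ^+ 2 + a * b * alpha + a ^+ 2 * beta)
                      / (d ^+ 2 + c * d * alpha + c ^+ 2 * beta)])).
Proof.
split=> [L tC|]; last split=> [alpha beta irr|alpha beta alpha' beta' irr _ L L' LP LP'].
- have [x [y [xL yL xy]]] := symplectic_pair tC.
  have [alpha [beta [b [bP _ _]]]] := pair_presentation tC xL yL xy.
  exists alpha, beta; split; first exact: presents_irreducible tC bP.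
  by exists b.
- split; first by exists (model (P10_44 alpha beta)); apply/model_presentation/P10_consistent.
  by move=> L [b bP]; apply: P10_type_C bP irr.
apply: (iff_trans _ (presentation_change _ _ irr LP)); split=> [LL'|LP''].
  exact: isomorphic_presentation (isomorphic_sym LL') LP'.
exact: presentation_isomorphic (P10_consistent _ _) LP'' LP'.
Qed.
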